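(* Let $U\subset\mathbb{R}^d$ be open and let $I\subset\mathbb{R}$ be an interval. Suppose $f:U\times I\to\mathbb{R}$, $(x,t)\mapsto f(x,t)$, is twice continuously differentiable in $x$, differentiable in $t$, and that $F(x,t)=\nabla_x f(x,t)$ is continuously differentiable in $(x,t)$. Assume also that mixed derivatives commute, so that $\partial_t\nabla_x f=\nabla_x\partial_t f$. Let $(x_0,t_0)\in U\times I$ satisfy $$\nabla_x f(x_0,t_0)=0,\qquad H_0:=\nabla_x^2 f(x_0,t_0)\ \text{ is nonsingular}.$$ Then there are neighborhoods $V$ of $x_0$ and $J$ of $t_0$ (in $I$), and a unique continuously differentiable curve $m:J\to V$, such that $$m(t_0)=x_0,\qquad \nabla_x f(m(t),t)=0\quad (t\in J).$$ Moreover, for $t\in J$, $$\dot m(t)=-\{\nabla_x^2 f(m(t),t)\}^{-1}\,(\nabla_x\partial_t f)(m(t),t).$$ If $H_0$ is negative definite, then after possibly shrinking $J$, the curve consists of local modes. For heat flow, that is, when $\partial_t f_t=\tfrac12\Delta f_t$ with $f_t=f(\cdot,t)$, the velocity formula becomes $$\dot m(t)=-\tfrac12\{\nabla_x^2 f_t(m(t))\}^{-1}\,\nabla_x\Delta f_t(m(t)).$$ Consequently, for $f:U\times I\to\mathbb{R}$ that is twice continuously differentiable in $x$ and differentiable in $t$, with $\nabla_x f$ continuously differentiable in $(x,t)$ and $\partial_t\nabla_x f=\nabla_x\partial_t f$, fix $t_0\in I$ and a compact set $K\subset U$. If no critical point of $f(\cdot,t_0)$ lies on $\partial K$, and all critical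 points of $f(\cdot,t_0)$ in $K$ are nondegenerate, then for all $t\in I$ sufficiently close to $t_0$, the number and Morse index of critical points of $f(\cdot,t)$ in $K$ are unchanged (i.e. the same as at $t_0$).
   Context: $\nabla_x f$, $\nabla_x^2 f$ and $\Delta f=\operatorname{tr}(\nabla_x^2 f)$ denote the gradient, Hessian and Laplacian with respect to $x$. A critical point of $f(\cdot,t)$ is a point $x\in U$ with $\nabla_x f(x,t)=0$; it is nondegenerate if $\nabla_x^2 f(x,t)$ is nonsingular. The Morse index of a nondegenerate critical point is the number of negative eigenvalues of its Hessian. A local mode of $f(\cdot,t)$ is a nondegenerate local maximum: a point $x$ with $\nabla_x f(x,t)=0$ and $\nabla_x^2 f(x,t)$ negative definite. *)

(* Defs.v *)
From HB Require Import structures.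
From mathcomp Require Import all_boot all_order all_algebra.
From mathcomp Require Import all_classical all_reals all_analysis.

Set Implicit Arguments.
Unset Strict Implicit.
Unset Printing Implicit Defensive.

Import Order.TTheory GRing.Theory Num.Theory.
Import numFieldNormedType.Exports.

Local Open Scope classical_set_scope.
Local Open Scope ring_scope.

(* Points of R^d are column vectors.  Functions on a subset (U, I, U x I, J) are
   represented by total functions of which only the values on the subset
   matter: U is open, so the library derivative ['D_v] at a point of U depends
   only on the values on U, and derivatives in time are taken relative to the
   interval (so they are one-sided at an end point that belongs to it). *)

Section SpaceDerivatives.
Context {R : realType} {d : nat}.

Definition basis_vec (i : 'I_d) : 'cV[R]_d := delta_mx i 0.

Definition has_partials {W : normedModType R} (g : 'cV[R]_d -> W)
    (x : 'cV[R]_d) : Prop :=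
  forall i, derivable g x (basis_vec i).

Definition grad (g : 'cV[R]_d -> R) (x : 'cV[R]_d) : 'cV[R]_d :=
  \col_i 'D_(basis_vec i) g x.

Definition hessian (g : 'cV[R]_d -> R) (x : 'cV[R]_d) : 'M[R]_d :=
  \matrix_(i, j) 'D_(basis_vec j) (fun y => grad g y i 0) x.

Definition laplacian (g : 'cV[R]_d -> R) (x : 'cV[R]_d) : R :=
  \tr (hessian g x).

Definition C1_on {W : normedModType R} (U : set 'cV[R]_d)
    (g : 'cV[R]_d -> W) : Prop :=
  (forall x, U x -> has_partials g x) /\
  (forall i, {within U, continuous (fun x => 'D_(basis_vec i) g x)}).

Definition C2_on (U : set 'cV[R]_d) (g : 'cV[R]_d -> R) : Prop :=
  C1_on U g /\ C1_on U (grad g).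

End SpaceDerivatives.

Section TimeDerivatives.
Context {R : realType}.

Definition diff_quotient {W : normedModType R} (g : R -> W) (t s : R) : W :=
  (s - t)^-1 *: (g s - g t).

Definition has_derive_within {W : normedModType R} (I : set R) (g : R -> W)
    (t : R) (v : W) : Prop :=
  diff_quotient g t @ within I t^' --> v.

Definition derivable_within {W : normedModType R} (I : set R) (g : R -> W)
    (t : R) : Prop :=
  exists v, has_derive_within I g t v.

Definition derive_within {W : normedModType R} (I : set R) (g : R -> W)
    (t : R) : W :=
  lim (diff_quotient g t @ within I t^').

(* Neighborhoods of t0 in I over which curves are defined. *)
Definition subinterval_nbhs (I : set R) (t0 : R) (J : set R) : Prop :=
  [/\ is_interval J, J t0 & exists2 O : set R, open O & J = O `&` I].

End TimeDerivatives.

Section Families.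
Context {R : realType} {d : nat}.

(* Continuous differentiability in (x, t) on U x I: all first order partial
   derivatives exist and are jointly continuous. *)
Definition C1_space_time {W : normedModType R} (U : set 'cV[R]_d) (I : set R)
    (F : 'cV[R]_d -> R -> W) : Prop :=
  [/\ forall x t, U x -> I t -> has_partials (F ^~ t) x,
      forall x t, U x -> I t -> derivable_within I (F x) t,
      forall i, {within U `*` I,
        continuous (fun z => 'D_(basis_vec i) (F ^~ z.2) z.1)}
    & {within U `*` I, continuous (fun z => derive_within I (F z.1) z.2)}].

Definition dt (I : set R) (f : 'cV[R]_d -> R -> R) (x : 'cV[R]_d) (t : R) : R :=
  derive_within I (f x) t.

Definition mixed_derivatives_commute (U : set 'cV[R]_d) (I : set R)
    (f : 'cV[R]_d -> R -> R) : Prop :=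
  forall x t, U x -> I t ->
    has_partials (dt I f ^~ t) x /\
    derive_within I (fun s => grad (f ^~ s) x) t = grad (dt I f ^~ t) x.

Definition heat_flow (U : set 'cV[R]_d) (I : set R)
    (f : 'cV[R]_d -> R -> R) : Prop :=
  forall x t, U x -> I t -> dt I f x t = 2^-1 * laplacian (f ^~ t) x.

Definition C1_curve (J : set R) (V : set 'cV[R]_d) (m : R -> 'cV[R]_d) : Prop :=
  [/\ forall t, J t -> V (m t),
      forall t, J t -> derivable_within J m t
    & {within J, continuous (derive_within J m)}].

Definition critical_curve (f : 'cV[R]_d -> R -> R) (x0 : 'cV[R]_d) (t0 : R)
    (J : set R) (V : set 'cV[R]_d) (m : R -> 'cV[R]_d) : Prop :=
  [/\ C1_curve J V m, m t0 = x0
    & forall t, J t -> grad (f ^~ t) (m t) = 0].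

End Families.

Section CriticalPoints.
Context {R : realType} {d : nat}.

Definition negative_definite (H : 'M[R]_d) : Prop :=
  forall v : 'cV[R]_d, v != 0 -> (v^T *m H *m v) 0 0 < 0.

Definition critical_at (g : 'cV[R]_d -> R) (x : 'cV[R]_d) : Prop :=
  grad g x = 0.

Definition nondegenerate_at (g : 'cV[R]_d -> R) (x : 'cV[R]_d) : Prop :=
  hessian g x \in unitmx.

Definition local_mode (g : 'cV[R]_d -> R) (x : 'cV[R]_d) : Prop :=
  critical_at g x /\ negative_definite (hessian g x).

(* Negative eigenvalues are counted with multiplicity. *)
Definition morse_index (g : 'cV[R]_d -> R) (x : 'cV[R]_d) : nat :=
  \big[addn/0%N]_(a \in [set a : R | a < 0 /\ eigenvalue (hessian g x) a])
    mup a (char_poly (hessian g x)).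

Definition critical_set (K : set 'cV[R]_d) (g : 'cV[R]_d -> R) :
    set 'cV[R]_d :=
  [set x | K x /\ critical_at g x].

Definition boundary (K : set 'cV[R]_d) : set 'cV[R]_d :=
  closure K `\` interior K.

(* The critical points in K of g and of h are finitely many, nondegenerate, and
   correspond bijectively (in particular they are equally many) with equal
   Morse indices. *)
Definition same_number_and_index (K : set 'cV[R]_d)
    (g h : 'cV[R]_d -> R) : Prop :=
  [/\ finite_set (critical_set K g), finite_set (critical_set K h),
      forall x, critical_set K g x -> nondegenerate_at g x,
      forall x, critical_set K h x -> nondegenerate_at h x
    & exists2 phi : 'cV[R]_d -> 'cV[R]_d,
        set_bij (critical_set K g) (critical_set K h) phi
      & forall x, critical_set K g x -> morse_index h (phi x) = morse_index g x].

End CriticalPoints.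

(* Main.v *)
(* The critical points of f(., t) are the zeros of F(., t), where F = grad f.
   Put A = H0^-1.  By joint continuity the partial derivatives of
   x |-> x - A F(x, t) are uniformly small for (x, t) near (x0, t0), so by the mean
   value inequality these maps are contractions of a small cube (a ball of the sup
   norm), and their fixed points are the zeros of F(., t).  The same inequality,
   applied with the inverse of the Hessian at a point of the curve, gives its
   velocity.

   The Hessian is symmetric because f(., t) is C^2, and by the spectral theorem
   over R[i] its inertia does not change under small perturbations: a form that is
   definite on an eigenspace stays so.  This gives the stability of local modes and
   of the Morse index.  Finally K is covered by neighborhoods that contain either
   one branch of critical points or none; compactness makes the covering finite and
   the time interval uniform. *)
Require Import Defs.
From HB Require Import structures.
From mathcomp Require Import all_boot all_order all_algebra complex lra ring.
From mathcomp Require Import all_classical all_reals all_analysis.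

Import Order.TTheory GRing.Theory Num.Theory.
Import numFieldNormedType.Exports.

Local Open Scope classical_set_scope.
Local Open Scope ring_scope.

Set Implicit Arguments.
Unset Strict Implicit.
Unset Printing Implicit Defensive.

(** * Inertia of symmetric matrices *)

Section HermitianForms.
Local Open Scope sesquilinear_scope.
Context {C : numClosedFieldType} {n : nat}.
Implicit Types (A B P Q : 'M[C]_n) (D E v : 'rV[C]_n).

Definition hform A v : C := (v *m A *m v^t*) 0 0.

Definition sqnorm v : C := \sum_i `|v 0 i| ^+ 2.

(** The eigenvalues are kept as the entries of a row, so that counting indices of a given sign
    counts eigenvalues with multiplicity. *)
Definition unitarily_diagonalized A P D : Prop :=
  [/\ P \is unitarymx, forall i, D 0 i \is Num.real
    & A = P^t* *m diag_mx D *m P].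

Lemma sqnormE v : sqnorm v = (v *m v^t*) 0 0.
Proof. by rewrite mxE; apply: eq_bigr => i _; rewrite !mxE normCK. Qed.

Lemma sqnorm_gt0 v : v != 0 -> 0 < sqnorm v.
Proof.
move=> /rV0Pn[i vi]; rewrite /sqnorm (bigD1 i)//=.
apply: ltr_pwDl; first by rewrite exprn_gt0// normr_gt0.
by apply: sumr_ge0 => j _; rewrite exprn_ge0.
Qed.

Lemma hform_diag D v : hform (diag_mx D) v = \sum_i D 0 i * `|v 0 i| ^+ 2.
Proof.
rewrite /hform mxE; apply: eq_bigr => i _.
by rewrite mul_mx_diag !mxE normCK mulrCA !mulrA.
Qed.

Lemma hform_unitary P A v : hform (P^t* *m A *m P) v = hform A (v *m P^t*).
Proof.
by rewrite /hform !mulmxA trmx_mul map_mxM/= trmxCK !mulmxA.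
Qed.

Lemma sqnorm_unitary P v : P \is unitarymx -> sqnorm (v *m P^t*) = sqnorm v.
Proof.
move=> uP; rewrite !sqnormE trmx_mul map_mxM/= trmxCK !mulmxA.
by rewrite -(invmx_unitary uP) mulmxKV// unitarymx_unit.
Qed.

Lemma hformN A v : hform (- A) v = - hform A v.
Proof. by rewrite /hform mulmxN mulNmx mxE. Qed.

Lemma hformB A B v : hform (A - B) v = hform A v - hform B v.
Proof. by rewrite /hform mulmxBr mulmxBl !mxE. Qed.

Lemma unitarily_diagonalizedN A P D :
  unitarily_diagonalized A P D -> unitarily_diagonalized (- A) P (- D).
Proof.
move=> [uP Dr ->]; split=> // [i|]; first by rewrite mxE rpredN.
by rewrite (raddfN (@diag_mx C n)) mulmxN mulNmx.
Qed.

Lemma ltn_kernel_row (p q : nat) (M : 'M[C]_(p, q)) : (q < p)%N ->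
  exists2 u : 'rV_p, u != 0 & u *m M = 0.
Proof.
move=> qp; have : kermx M != 0.
  by rewrite -mxrank_eq0 mxrank_ker -lt0n subn_gt0 (leq_ltn_trans (rank_leq_col M)).
by move=> /rowV0Pn[u /sub_kermxP uM u0]; exists u.
Qed.

(* If A had more negative eigenvalues than B, some nonzero vector would lie both in
   the negative eigenspace of A and in the nonnegative eigenspace of B. *)
Lemma negative_eigenvalues_le A B P Q D E (c : C) :
  unitarily_diagonalized A P D -> unitarily_diagonalized B Q E ->
  0 < c -> (forall i, c <= `|D 0 i|) ->
  (forall v, v != 0 -> `|hform (B - A) v| < c * sqnorm v) ->
  (#|[pred i | (D 0 i < 0)%R]| <= #|[pred i | (E 0 i < 0)%R]|)%N.
Proof.
move=> [uP Dr AE] [uQ Er BE] c0 cD close; rewrite leqNgt; apply/negP => lt.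
pose f (j : 'I_#|[pred i | (D 0 i < 0)%R]|) : 'I_n := enum_val j.
pose g (j : 'I_#|[pred i | (E 0 i < 0)%R]|) : 'I_n := enum_val j.
(* The unknowns are coefficients on the rows of [P] with negative eigenvalue of [A]; the equations
   make the combination orthogonal to the rows of [Q] with negative eigenvalue of [B]. Below, [z]
   extends [u] by zeros and [v] is the combination itself. *)
have [u u0 uM] := ltn_kernel_row (colsub g (rowsub f P *m Q^t*)) lt.
pose z : 'rV_n := u *m rowsub f 1%:M.
pose v := z *m P.
have zE i : z 0 i = \sum_j u 0 j * (f j == i)%:R.
  by rewrite mxE; apply: eq_bigr => j _; rewrite !mxE.
have zf j : z 0 (f j) = u 0 j.
  rewrite zE (bigD1 j)//= eqxx mulr1 big1 ?addr0// => k kj.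
  by rewrite (inj_eq enum_val_inj) (negbTE kj) mulr0.
have znneg i : ~~ (D 0 i < 0) -> z 0 i = 0.
  move=> Di; rewrite zE big1// => j _; case: eqP => [fji|]; last by rewrite mulr0.
  by have := enum_valP j; rewrite -/(f j) fji inE (negbTE Di).
have z0 : z != 0.
  by have [j uj] := rV0Pn _ u0; apply/rV0Pn; exists (f j); rewrite zf.
have vP : v *m P^t* = z.
  by rewrite /v -(invmx_unitary uP) mulmxK// unitarymx_unit.
have v0 : v != 0.
  by apply: contraNneq z0 => v0; rewrite -vP v0 mul0mx.
have sqv : sqnorm v = sqnorm z by rewrite -(sqnorm_unitary _ uP) vP.
have hA : hform A v <= - (c * sqnorm v).
  rewrite AE hform_unitary hform_diag vP sqv /sqnorm mulr_sumr -sumrN.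
  apply: ler_sum => i _; have [Di|/znneg ->] := boolP (D 0 i < 0); last first.
    by rewrite normr0 expr0n/= !mulr0 oppr0.
  rewrite -mulNr ler_wpM2r ?exprn_ge0// lerNr -(ltr0_norm Di).
  exact: cD.
have hB : 0 <= hform B v.
  rewrite BE hform_unitary hform_diag; apply: sumr_ge0 => i _.
  have [Ei|nEi] := boolP (E 0 i < 0); last first.
    by rewrite mulr_ge0 ?exprn_ge0// real_leNgt.
  have iin : i \in [pred i | (E 0 i < 0)%R] by rewrite inE.
  suff -> : (v *m Q^t*) 0 i = 0 by rewrite normr0 expr0n/= mulr0.
  have /rowP/(_ (enum_rank_in iin i)) := uM.
  rewrite mulmx_colsub mulmxA mxE [X in (_ *m X *m _) _ _]rowsubE.
  by rewrite mulmxA -/z -/v /g enum_rankK_in//= => ->; rewrite mxE.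
have := close v v0; rewrite hformB ger0_norm; last first.
  rewrite subr_ge0 (le_trans hA)// (le_trans _ hB)// oppr_le0.
  by rewrite mulr_ge0// ltW// sqnorm_gt0.
by move=> /lt_geF/negbT/negP; apply; rewrite -[leLHS]add0r lerD// lerNr.
Qed.

Lemma card_lt0_gt0 D : (forall i, D 0 i \is Num.real) ->
  (#|[pred i | (D 0 i < 0)%R]| + #|[pred i | (0 < D 0 i)%R]| <= n)%N.
Proof.
move=> Dr; rewrite -cardUI [X in (_ + X)%N]eq_card0 ?addn0.
  by rewrite -[leqRHS]card_ord max_card.
by move=> i; rewrite !inE; apply/negP => /andP[/lt_trans h /h]; rewrite ltxx.
Qed.

(* Applied to the opposite forms, the inequality above also bounds the number of
   positive eigenvalues, hence it is an equality. *)
Lemma card_negative_eigenvalues A B P Q D E (c : C) :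
  unitarily_diagonalized A P D -> unitarily_diagonalized B Q E ->
  0 < c -> (forall i, c <= `|D 0 i|) ->
  (forall v, v != 0 -> `|hform (B - A) v| < c * sqnorm v) ->
  #|[pred i | (E 0 i < 0)%R]| = #|[pred i | (D 0 i < 0)%R]|.
Proof.
move=> dA dB c0 cD close.
have neg := negative_eigenvalues_le dA dB c0 cD close.
have pos : (#|[pred i | (0 < D 0 i)%R]| <= #|[pred i | (0 < E 0 i)%R]|)%N.
  have := negative_eigenvalues_le (unitarily_diagonalizedN dA)
    (unitarily_diagonalizedN dB) c0.
  rewrite (eq_card (B := [pred i | (0 < D 0 i)%R])); last first.
    by move=> i; rewrite !inE mxE oppr_lt0.
  rewrite [X in (_ <= X)%N](eq_card (B := [pred i | (0 < E 0 i)%R])); last first.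
    by move=> i; rewrite !inE mxE oppr_lt0.
  apply=> [i|v v0]; first by rewrite mxE normrN.
  by rewrite -opprD hformN normrN; apply: close.
(* The gap [c] excludes zero eigenvalues of [A], so its two counts add up to [n]. Those of [B] add
   up to at most [n], which with [pos] bounds the negative count of [B] from above. *)
have Dn : (#|[pred i | (D 0 i < 0)%R]| + #|[pred i | (0 < D 0 i)%R]| = n)%N.
  rewrite -cardUI [X in (_ + X)%N]eq_card0 ?addn0; last first.
    by move=> i; rewrite !inE; apply/negP => /andP[/lt_trans h /h]; rewrite ltxx.
  rewrite -[RHS]card_ord; apply: eq_card => i; rewrite !inE.
  have [_ Dr _] := dA; rewrite -real_neqr_lt ?real0 ?Dr//.
  by rewrite -normr_gt0 (lt_le_trans c0).
have En : (#|[pred i | (E 0 i < 0)%R]| + #|[pred i | (0 < E 0 i)%R]| <= n)%N.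
  by have [_ Er _] := dB; exact: card_lt0_gt0.
by apply/eqP; rewrite eqn_leq neg andbT -(leq_add2r #|[pred i | (0 < D 0 i)%R]|)
  Dn (leq_trans _ En)// leq_add2l.
Qed.

(** Each product [|v_i| |v_j|] is at most the mean of the two squares; summing these means over all
    pairs gives [n] times the squared norm. *)
Lemma hform_le A v (e : C) : (forall i j, `|A i j| <= e) ->
  `|hform A v| <= e * n%:R * sqnorm v.
Proof.
move=> Ae; rewrite /hform mxE.
have -> : e * n%:R * sqnorm v =
    \sum_i \sum_j e * ((`|v 0 i| ^+ 2 + `|v 0 j| ^+ 2) / 2%:R).
  under eq_bigr do rewrite -mulr_sumr -mulr_suml big_split/= sumr_const card_ord.
  rewrite -mulr_sumr -mulr_suml big_split/= sumr_const card_ord -sumrMnl.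
  rewrite !sumrMnl -mulr2n -[X in X / _]mulr_natr mulfK ?pnatr_eq0//.
  by rewrite -[in RHS]mulr_natr mulrAC mulrA.
rewrite exchange_big/= (le_trans (ler_norm_sum _ _ _))//.
apply: ler_sum => j _; rewrite !mxE mulr_suml (le_trans (ler_norm_sum _ _ _))//.
apply: ler_sum => i _; rewrite !normrM norm_conjC mulrAC mulrC ler_pM//.
by rewrite real_leif_mean_square ?normr_real.
Qed.

End HermitianForms.

(** * Real symmetric matrices, through the spectral theorem over the complex numbers *)

Section RealSymmetricMatrices.
Local Open Scope sesquilinear_scope.
Context {R : realType} {n : nat}.
Local Notation toC := (map_mx (real_complex R)).
Implicit Types (H : 'M[R]_n) (r v : 'rV[R]_n).

Lemma char_poly_conj (F : comUnitRingType) (P A : 'M[F]_n) : P \in unitmx ->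
  char_poly (invmx P *m A *m P) = char_poly A.
Proof.
move=> uP; rewrite /char_poly /char_poly_mx.
have PK : map_mx polyC (invmx P) *m map_mx polyC P = 1%:M.
  by rewrite -map_mxM mulVmx// map_mx1.
have -> : 'X%:M - map_mx polyC (invmx P *m A *m P) =
    map_mx polyC (invmx P) *m ('X%:M - map_mx polyC A) *m map_mx polyC P.
  by rewrite mulmxBr mulmxBl !map_mxM/= mul_mx_scalar -scalemxAl PK scalemx1.
by rewrite !det_mulmx mulrAC -det_mulmx PK det1 mul1r.
Qed.

(** Over [R[i]] the matrix is Hermitian, so its spectral diagonal is real. The factorization of the
    characteristic polynomial is proved over [R[i]] and descends to [R] because the embedding of
    polynomials is injective. *)
Lemma symmetric_diagonalized H : H^T = H ->
  exists (P : 'M[R[i]]_n) r, unitarily_diagonalized (toC H) P (toC r) /\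
    char_poly H = \prod_i ('X - (r 0 i)%:P).
Proof.
move=> Hsym.
have hH : toC H \is hermsymmx.
  apply/is_hermitianmxP; rewrite expr0 scale1r; apply/matrixP => i j.
  by rewrite -[in LHS]Hsym !mxE; apply/esym/CrealP; rewrite complex_real.
have /orthomx_spectralP HE := hermitian_normalmx hH.
set P := spectralmx (toC H) in HE; set D := spectral_diag (toC H) in HE.
have Dr : D \is a mxOver Num.real by exact: hermitian_spectral_diag_real.
pose r : 'rV[R]_n := map_mx (@complex.Re R) D.
have rD : toC r = D.
  by apply/rowP => i; rewrite !mxE RRe_real//; apply/mxOverP.
exists P, r; split.
  split; first exact: spectral_unitarymx.
    by move=> i; rewrite rD; apply/mxOverP.
  by rewrite rD -invmx_unitary ?spectral_unitarymx.
apply: (map_poly_inj (real_complex R)).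
rewrite map_char_poly rmorph_prod/= HE char_poly_conj ?spectral_unit//.
rewrite char_poly_trig ?diag_mx_is_trig//; apply: eq_bigr => i _.
by rewrite rmorphB/= map_polyX map_polyC/= -rD !mxE eqxx.
Qed.

Lemma mup_prod_XsubC (I : finType) (r : I -> R) (a : R) :
  mup a (\prod_i ('X - (r i)%:P)) = (\sum_i (r i == a))%N.
Proof.
(* Nonvanishing is carried through the induction, since multiplicities add only for nonzero
   polynomials. *)
suff [] : mup a (\prod_i ('X - (r i)%:P)) = (\sum_i (r i == a))%N /\
  \prod_i ('X - (r i)%:P) != 0 by [].
elim/big_ind2 : _ => [|p m q k [<- p0] [<- q0]|i _].
- by rewrite mupNroot ?oner_eq0// rootC oner_eq0.
- by rewrite mupM// mulf_neq0.
- by rewrite -[X in mup _ X]expr1 mup_XsubCX polyXsubC_eq0; case: (r i == a).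
Qed.

Lemma eigenvalue_prod H r i : char_poly H = \prod_i ('X - (r 0 i)%:P) ->
  eigenvalue H (r 0 i).
Proof.
move=> HE; rewrite eigenvalue_root_char HE /root horner_prod (bigD1 i)//=.
by rewrite hornerXsubC subrr mul0r.
Qed.

(** This links the Morse index to the counts of the inertia lemmas. After exchanging the sums, an
    index [i] with negative [r 0 i] is counted exactly once, at the eigenvalue [a] equal to
    [r 0 i]. *)
Lemma count_negative_eigenvalues H r : char_poly H = \prod_i ('X - (r 0 i)%:P) ->
  \big[addn/0%N]_(a \in [set a : R | a < 0 /\ eigenvalue H a])
    mup a (char_poly H) = #|[pred i | (r 0 i < 0)%R]|.
Proof.
move=> HE; pose s := undup [seq r 0 i | i <- enum [pred i | (r 0 i < 0)%R]].
have sE a : (a \in s) = (a < 0) && eigenvalue H a.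
  rewrite mem_undup eigenvalue_root_char HE; apply/mapP/andP.
    move=> [k]; rewrite mem_enum inE => rk ->; split=> //.
    by rewrite /root horner_prod prodf_seq_eq0; apply/hasP; exists k;
      rewrite ?mem_index_enum//= hornerXsubC subrr.
  move=> [a0]; rewrite /root horner_prod prodf_seq_eq0 => /hasP[i _ /=].
  rewrite hornerXsubC subr_eq0 => /eqP ai; exists i => //.
  by rewrite mem_enum inE -ai.
rewrite (fsbig_fwiden s) ?undup_uniq//; last first.
- by move=> a [/=]; rewrite sE => /andP[-> ->] [].
- by move=> a /=; rewrite sE => -[-> ->].
under eq_bigr do rewrite HE mup_prod_XsubC.
rewrite exchange_big/= -sum1_card [RHS]big_mkcond/=; apply: eq_bigr => i _.
rewrite (eq_bigr (fun a => (a == r 0 i : nat))); last by move=> a _; rewrite eq_sym.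
rewrite -big_mkcond/= sum1_count count_uniq_mem ?undup_uniq// sE.
by rewrite (eigenvalue_prod _ HE) andbT unfold_in/=; case: ifP.
Qed.

Lemma nonsingular_eigenvalue H a : H \in unitmx -> eigenvalue H a -> a != 0.
Proof.
move=> uH /eigenvalueP[v vH v0]; apply: contraNneq v0 => a0.
by rewrite -(mulmxK uH v) vH a0 scale0r mul0mx.
Qed.

Lemma entrywise_close_hform H H' (c : R) : 0 < c ->
  (forall i j, `|H' i j - H i j| <= c / n.+1%:R) ->
  forall v : 'rV[R[i]]_n, v != 0 ->
  `|hform (toC H' - toC H) v| < real_complex R c * sqnorm v.
Proof.
move=> c0 HH' v v0.
(* The bound on a form costs a factor [n]; dividing by [n.+1] leaves room for the strict
   inequality. *)
apply: (@le_lt_trans _ _ (real_complex R (c / n.+1%:R) * n%:R * sqnorm v)).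
  apply: hform_le => i j; rewrite !mxE -rmorphB/= normc_def/= expr0n/= addr0.
  by rewrite sqrtr_sqr lecR.
rewrite ltr_pM2r ?sqnorm_gt0// -(rmorph_nat (real_complex R)) -rmorphM/= ltcR.
by rewrite mulrAC ltr_pdivrMr ?ltr0n// ltr_pM2l// ltr_nat.
Qed.

(** Nonsingularity gives a gap [c] between the eigenvalues and zero, and a perturbation whose form
    is smaller than the gap cannot change the number of negative ones. *)
Lemma morse_index_stable H : H^T = H -> H \in unitmx ->
  exists2 e : R, 0 < e & forall H', H'^T = H' ->
    (forall i j, `|H' i j - H i j| <= e) ->
    \big[addn/0%N]_(a \in [set a : R | a < 0 /\ eigenvalue H' a])
      mup a (char_poly H') =
    \big[addn/0%N]_(a \in [set a : R | a < 0 /\ eigenvalue H a])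
      mup a (char_poly H).
Proof.
move=> Hsym uH; have [P [r [dH cH]]] := symmetric_diagonalized Hsym.
(* The default 1 keeps the gap positive in dimension zero. *)
pose c := \big[Num.min/1]_i `|r 0 i|.
have c0 : 0 < c.
  apply/bigmin_gtP; split=> // i _; rewrite normr_gt0.
  exact/(nonsingular_eigenvalue uH)/eigenvalue_prod.
exists (c / n.+1%:R) => [|H' H'sym close]; first by rewrite divr_gt0.
have [Q [s [dH' cH']]] := symmetric_diagonalized H'sym.
apply: etrans (count_negative_eigenvalues cH') (etrans _
  (esym (count_negative_eigenvalues cH))).
have := card_negative_eigenvalues (c := real_complex R c) dH dH'.
rewrite (eq_card (B := [pred i | (s 0 i < 0)%R])); last first.
  by move=> i; rewrite !inE mxE ltcR.
rewrite [RHS](eq_card (B := [pred i | (r 0 i < 0)%R])); last first.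
  by move=> i; rewrite !inE mxE ltcR.
apply; first by rewrite ltcR.
  move=> i; rewrite mxE normc_def/= expr0n/= addr0 sqrtr_sqr lecR.
  exact: bigmin_le.
exact: entrywise_close_hform.
Qed.

(** All eigenvalues of [H] are at most [- c], so its form is at most [- c] times the squared norm,
    and a small change of the entries moves it by less. The transposes pass from the columns of
    [negative_definite] to the rows of [hform]. *)
Lemma negative_definite_stable H : H^T = H -> negative_definite H ->
  exists2 e : R, 0 < e & forall H',
    (forall i j, `|H' i j - H i j| <= e) -> negative_definite H'.
Proof.
move=> Hsym nH; have [P [r [[uP _ HE] cH]]] := symmetric_diagonalized Hsym.
have r0 i : r 0 i < 0.
  have /eigenvalueP[v vH v0] := eigenvalue_prod i cH.
  have vT0 : v^T != 0 by apply: contraNneq v0 => vT; rewrite -[v]trmxK vT trmx0.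
  have := nH v^T vT0; rewrite trmxK vH -scalemxAl mxE.
  rewrite !ltNge; apply: contraNN => ri; rewrite mulr_ge0//.
  by rewrite mxE sumr_ge0// => j _; rewrite mxE -expr2 sqr_ge0.
pose c := \big[Num.min/1]_i `|r 0 i|.
have c0 : 0 < c.
  by apply/bigmin_gtP; split=> // i _; rewrite normr_gt0 lt_eqF.
exists (c / n.+1%:R) => [|H' close v v0]; first by rewrite divr_gt0.
pose w : 'rV[R[i]]_n := toC v^T.
have w0 : w != 0 by rewrite map_mx_eq0 trmx_eq0.
have hformE (G : 'M[R]_n) : hform (toC G) w = real_complex R ((v^T *m G *m v) 0 0).
  rewrite /hform; have -> : w^t* = toC v.
    by apply/matrixP => i j; rewrite !mxE; apply/CrealP; rewrite complex_real.
  by rewrite -!map_mxM mxE.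
rewrite -ltcR -hformE.
have hH : hform (toC H) w <= - (real_complex R c * sqnorm w).
  rewrite HE hform_unitary hform_diag -(sqnorm_unitary w uP) /sqnorm mulr_sumr -sumrN.
  apply: ler_sum => i _; rewrite -mulNr ler_wpM2r ?exprn_ge0// mxE -rmorphN lecR.
  by rewrite lerNr -ltr0_norm//; exact: bigmin_le.
have := entrywise_close_hform c0 close w0.
rewrite hformB => lt; rewrite -(subrK (hform (toC H) w) (hform _ w)).
rewrite (le_lt_trans (lerD (real_ler_norm _) hH))//.
  by rewrite !hformE rpredB// complex_real.
by rewrite subr_lt0.
Qed.

End RealSymmetricMatrices.

(** * Mean value inequalities and symmetry of the Hessian *)

Lemma near_dist_lt (R : realType) (V : normedModType R) (x : V) (e : R) :
  0 < e -> \forall z \near x, `|x - z| < e.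
Proof.
by move=> e0; apply: (@cvgr_dist_lt _ _ _ (nbhs x) _ id x) => //; exact: cvg_id.
Qed.

(** * Sup norm estimates for matrices *)

Section MatrixNorm.
Context {R : realType}.

Lemma normr_entry_le m n (w : 'M[R]_(m, n)) i j : `|w i j| <= `|w|.
Proof.
rewrite [leRHS]/Num.Def.normr/= mx_normrE.
exact: (@le_bigmax _ _ _ _ (fun ij => `|w ij.1 ij.2|) (i, j)).
Qed.

Lemma normr_mx_le m n (w : 'M[R]_(m, n)) (c : R) : 0 <= c ->
  (forall i j, `|w i j| <= c) -> `|w| <= c.
Proof.
move=> c0 wc; rewrite [leLHS]/Num.Def.normr/= mx_normrE.
by apply/bigmax_leP; split=> // -[i j] _; exact: wc.
Qed.

Lemma normr_mulmx_le m n (A : 'M[R]_(m, n)) (w : 'cV[R]_n) :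
  `|A *m w| <= n%:R * `|A| * `|w|.
Proof.
apply: normr_mx_le => [|i j]; first by rewrite !mulr_ge0.
rewrite mxE (le_trans (ler_norm_sum _ _ _))//.
rewrite (le_trans (ler_sum _ (G := fun=> `|A| * `|w|) _))//.
  by move=> k _; rewrite normrM ler_pM// normr_entry_le.
by rewrite sumr_const card_ord -[leLHS]mulr_natl mulrA.
Qed.

Lemma mulmx_continuous m n (A : 'M[R]_(m, n)) :
  continuous (fun w : 'cV[R]_n => A *m w).
Proof.
move=> w; apply/(@cvgrPdist_lt _ _ _ (nbhs w)) => e e0.
have c0 : 0 < n%:R * `|A| + 1 by rewrite ltr_wpDl// mulr_ge0.
apply: filterS (near_dist_lt w (divr_gt0 e0 c0)) => z.
rewrite ltr_pdivlMr// mulrC => zw; rewrite -mulmxBr.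
rewrite (le_lt_trans (normr_mulmx_le _ _))// (le_lt_trans _ zw)//.
by rewrite ler_wpM2r// lerDl.
Qed.

Lemma cV_sum_basis n (w : 'cV[R]_n) : w = \sum_i w i 0 *: basis_vec i.
Proof.
by rewrite {1}[w]matrix_sum_delta; apply: eq_bigr => i _; rewrite big_ord1.
Qed.

Lemma normr_mulmx_basis_le m n (M : 'M[R]_(m, n)) (c : R) (w : 'cV[R]_n) :
  (forall j, `|M *m basis_vec j| <= c) -> `|M *m w| <= n%:R * c * `|w|.
Proof.
move=> Mc; rewrite {1}[w]cV_sum_basis mulmx_sumr (le_trans (ler_norm_sum _ _ _))//.
rewrite (le_trans (ler_sum _ (G := fun=> c * `|w|) _))//.
  move=> k _; rewrite -scalemxAr normrZ mulrC ler_pM//.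
  exact: normr_entry_le.
by rewrite sumr_const card_ord -[leLHS]mulr_natl mulrA.
Qed.

End MatrixNorm.

(** Completeness of the space of columns is what the Banach fixed point theorem in [implicit_local]
    relies on. *)
HB.instance Definition _ (R : realType) m n := Complete.on 'M[R]_(m, n).

Section LineDerivatives.
Context {R : realType}.

Lemma is_derive_cvgP (V W : normedModType R) (g : V -> W) x v (D : W) :
  is_derive x v g D <->
  h^-1 *: (g (h *: v + x) - g x) @[h --> 0^'] --> D.
Proof.
split=> [[ex <-]|cv]; first exact: ex.
by apply: DeriveDef; [apply/cvg_ex; exists D|apply/cvg_lim].
Qed.

Lemma is_derive_line (V W : normedModType R) (g : V -> W) y v s (D : W) :
  is_derive (s *: v + y) v g D ->
  is_derive s 1 (fun u : R => g (u *: v + y)) D.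
Proof.
move=> /is_derive_cvgP gD; apply/(@is_derive_cvgP R^o W).
rewrite (_ : (fun h => _) =
  (fun h => h^-1 *: (g (h *: v + (s *: v + y)) - g (s *: v + y))))//.
by apply/funext => h; rewrite addrA -scalerDl [h *: 1]mulr1.
Qed.

End LineDerivatives.

Section MeanValue.
Context {R : realType}.

Lemma mean_value_line (V : normedModType R) (g : V -> R) y v (h : R) : 0 <= h ->
  (forall s, 0 <= s <= h -> derivable g (s *: v + y) v) ->
  exists2 s, 0 <= s <= h & g (h *: v + y) - g y = 'D_v g (s *: v + y) * h.
Proof.
move=> h0 dg.
have dl s : 0 <= s <= h ->
    is_derive s 1 (fun u : R => g (u *: v + y)) ('D_v g (s *: v + y)).
  by move=> sh; apply: is_derive_line; apply: DeriveDef => //; exact: dg.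
have [||s] := @MVT_segment R (fun u => g (u *: v + y))
    (fun s => 'D_v g (s *: v + y)) 0 h h0.
- by move=> s; rewrite in_itv/= => /andP[s0 sh]; apply: dl; rewrite !ltW.
- apply: derivable_within_continuous => s; rewrite in_itv/= => /dl ds.
  exact: ex_derive.
by rewrite in_itv/= subr0 scale0r add0r => sh E; exists s.
Qed.

End MeanValue.

Lemma normr_mx_lt (R : realType) m n (w : 'M[R]_(m, n)) (c : R) : 0 < c ->
  (forall i j, `|w i j| < c) -> `|w| < c.
Proof.
move=> c0 wc; rewrite [ltLHS]/Num.Def.normr/= mx_normrE.
by apply/bigmax_ltP; split=> // -[i j] _; exact: wc.
Qed.

(** The ball is convex, so the bound on the derivative holds along the whole segment between two of
    its points. A negative step becomes positive when the end points are swapped. *)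
Lemma mean_value_segment (R : realType) (V : normedModType R) (g : V -> R)
    x0 (r c a : R) y v :
  (forall z, `|z - x0| < r -> derivable g z v /\ `|'D_v g z| <= c) ->
  `|y - x0| < r -> `|a *: v + y - x0| < r ->
  `|g (a *: v + y) - g y| <= c * `|a|.
Proof.
move=> dg; wlog a0 : a y / 0 <= a => [wlg yr ayr|yr ayr].
  have [a0|a0] := leP 0 a; first exact: wlg.
  have yE : - a *: v + (a *: v + y) = y by rewrite addrA -scalerDl addNr scale0r add0r.
  rewrite distrC -(normrN a); have := wlg (- a) (a *: v + y); rewrite yE.
  by apply=> //; rewrite oppr_ge0 ltW.
have [->|an0] := eqVneq a 0; first by rewrite scale0r add0r subrr normr0 mulr0.
have {an0} a0 : 0 < a by rewrite lt_neqAle eq_sym an0.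
have inball s : 0 <= s <= a -> `|s *: v + y - x0| < r.
  move=> /andP[s0 sa]; have [t [t0 t1 ->]] : exists t, [/\ 0 <= t, t <= 1 & s = t * a].
    exists (s / a); split; first by rewrite divr_ge0// ltW.
      by rewrite ler_pdivrMr// mul1r.
    by rewrite divfK// gt_eqF.
  have -> : (t * a) *: v + y - x0 = (1 - t) *: (y - x0) + t *: (a *: v + y - x0).
    rewrite -!addrA [t *: _]scalerDr scalerA [RHS]addrCA -scalerDl.
    by rewrite subrK scale1r.
  rewrite (le_lt_trans (ler_normD _ _))// !normrZ (ger0_norm t0) ger0_norm ?subr_ge0//.
  have [t00|tn0] := eqVneq t 0; first by rewrite t00 subr0 mul1r mul0r addr0.
  have tpos : 0 < t by rewrite lt_neqAle eq_sym tn0.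
  have -> : r = (1 - t) * r + t * r by ring.
  by rewrite ler_ltD ?ler_wpM2l ?ltr_pM2l// ?subr_ge0// ltW.
have [|s sa ->] := @mean_value_line R V g y v a (ltW a0).
  by move=> s /inball/dg[].
by rewrite normrM ler_wpM2r//; have [] := dg _ (inball s sa).
Qed.

Lemma mean_value_ball (R : realType) d (g : 'cV[R]_d -> R) x0 (r c : R) x y :
  (forall z, `|z - x0| < r -> forall i,
    derivable g z (basis_vec i) /\ `|'D_(basis_vec i) g z| <= c) ->
  `|x - x0| < r -> `|y - x0| < r -> `|g x - g y| <= d%:R * c * `|x - y|.
Proof.
move=> dg xr yr; have r0 : 0 < r by rewrite (le_lt_trans _ xr).
(* Move from y to x by changing one coordinate at a time: in the sup norm this
   path does not leave the ball. *)
pose p k : 'cV[R]_d := \col_i (if (i < k)%N then x i 0 else y i 0).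
have pr k : `|p k - x0| < r.
  apply: normr_mx_lt => // i j; rewrite ord1 !mxE; case: ifP => _.
    by have := normr_entry_le (x - x0) i 0; rewrite !mxE => /le_lt_trans; apply.
  by have := normr_entry_le (y - x0) i 0; rewrite !mxE => /le_lt_trans; apply.
have p0 : p 0%N = y by apply/colP => i; rewrite mxE.
have pd : p d = x by apply/colP => i; rewrite mxE ltn_ord.
suff H k : (k <= d)%N -> `|g (p k) - g (p 0%N)| <= k%:R * c * `|x - y|.
  by rewrite -[in leLHS]pd -[in X in `|_ - g X|]p0 H.
elim: k => [_|k IH kd]; first by rewrite subrr normr0 !mul0r.
have {IH} IH := IH (ltnW kd); pose i := Ordinal kd.
have pS : p k.+1 = (x i 0 - y i 0) *: basis_vec i + p k.
  apply/colP => j; rewrite !mxE eqxx andbT.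
  have [->|ji] := eqVneq j i; first by rewrite /= ltnS leqnn ltnn mulr1 subrK.
  rewrite mulr0 add0r ltnS leq_eqVlt; case: eqP => //= jk.
  by case/eqP: ji; exact: val_inj.
rewrite -(subrKA (g (p k))) (le_trans (ler_normD _ _))// -natr1 !mulrDl mul1r addrC.
rewrite lerD// pS (le_trans (@mean_value_segment _ _ g x0 r c _ _ _ _ _ _))//.
- by move=> z /dg/(_ i).
- by rewrite -pS.
have c0 : 0 <= c by have [_ /(le_trans _)->] := dg _ xr i.
by rewrite ler_wpM2l//; have := normr_entry_le (x - y) i 0; rewrite !mxE.
Qed.

(* The mean value theorem used twice; the left hand side is symmetric in v and w. *)
Lemma second_difference (R : realType) (V : normedModType R) (g : V -> R) x v w (h : R) :
  0 <= h ->
  (forall s t, 0 <= s <= h -> 0 <= t <= h ->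
    derivable g (t *: w + (s *: v + x)) v /\
    derivable ('D_v g) (t *: w + (s *: v + x)) w) ->
  exists s t, [/\ 0 <= s <= h, 0 <= t <= h &
    g (h *: w + (h *: v + x)) - g (h *: v + x) - g (h *: w + x) + g x =
    'D_w ('D_v g) (t *: w + (s *: v + x)) * h ^+ 2].
Proof.
move=> h0 dg.
have hh : 0 <= h <= h by rewrite h0 lexx.
have h00 : 0 <= (0 : R) <= h by rewrite lexx h0.
have dl t s : 0 <= t <= h -> 0 <= s <= h ->
    is_derive s 1 (fun u : R => g (t *: w + (u *: v + x)))
      ('D_v g (t *: w + (s *: v + x))).
  move=> th sh; have -> : (fun u : R => g (t *: w + (u *: v + x))) =
      (fun u : R => g (u *: v + (t *: w + x))).
    by apply/funext => u; rewrite addrCA.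
  apply: is_derive_line; rewrite addrCA; apply: DeriveDef => //.
  by have [] := dg s t sh th.
pose phi := (fun u : R => g (h *: w + (u *: v + x))) -
  (fun u : R => g (0 *: w + (u *: v + x))).
have dphi s : 0 <= s <= h -> is_derive s 1 phi
   ('D_v g (h *: w + (s *: v + x)) - 'D_v g (0 *: w + (s *: v + x))).
  by move=> sh; apply: is_deriveB; exact: dl.
have [||s] := @MVT_segment R phi (fun s => 'D_v g (h *: w + (s *: v + x)) -
    'D_v g (0 *: w + (s *: v + x))) 0 h h0.
- by move=> s; rewrite in_itv/= => /andP[s0 sh]; apply: dphi; rewrite !ltW.
- apply: derivable_within_continuous => s; rewrite in_itv/= => /dphi ds.
  exact: ex_derive.
rewrite in_itv/= subr0 scale0r add0r => sh E.
have [|t th E2] := @mean_value_line R V ('D_v g) (s *: v + x) w h h0.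
  by move=> t th; have [] := dg s t sh th.
exists s, t; split=> //; rewrite expr2 mulrA -E2.
rewrite -E.
by rewrite /phi !fctE !scale0r !add0r; ring.
Qed.

Lemma near_eq_continuous_at (T U : topologicalType) (f g : T -> U) (x : T) :
  (\forall y \near x, f y = g y) -> {for x, continuous f} -> {for x, continuous g}.
Proof.
move=> fg cf; rewrite /prop_for /continuous_at -(nbhs_singleton fg).
exact: cvg_trans (near_eq_cvg fg) cf.
Qed.

Lemma dist_le_halves (R : numFieldType) (V : normedZmodType R) (a b c : V) (e : R) :
  `|a - c| < e / 2 -> `|b - c| < e / 2 -> `|a - b| <= e.
Proof.
move=> ac bc; rewrite (le_trans (ler_distD c _ _))// [e]splitr.
by apply: lerD; [exact: ltW|rewrite distrC; exact: ltW].
Qed.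

(** This is Schwarz's theorem. One and the same second difference equals [h ^+ 2] times either mixed
    derivative, each taken at some point near [x]; continuity then brings both values to [x] up to
    an arbitrary [e]. *)
Lemma mixed_derivatives_sym (R : realType) (V : normedModType R) (g : V -> R) x v w :
  (\forall y \near x, [/\ derivable g y v, derivable g y w,
    derivable ('D_v g) y w & derivable ('D_w g) y v]) ->
  {for x, continuous ('D_w ('D_v g))} -> {for x, continuous ('D_v ('D_w g))} ->
  'D_w ('D_v g) x = 'D_v ('D_w g) x.
Proof.
move=> dg /cvgrPdist_lt cwv /cvgrPdist_lt cvw.
apply/eqP; rewrite -subr_eq0 -normr_le0; apply/ler_addgt0Pr => e e0; rewrite add0r.
have e20 : 0 < e / 2 by rewrite divr_gt0.
have /nbhs_ballP[rho /= rho0] : \forall y \near x, [/\ derivable g y v, derivable g y w,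
    derivable ('D_v g) y w & derivable ('D_w g) y v] /\
    (`|('D_w ('D_v g) x : R) - 'D_w ('D_v g) y| < e / 2 /\
     `|('D_v ('D_w g) x : R) - 'D_v ('D_w g) y| < e / 2).
  by apply: filterI => //; apply: filterI; [exact: cwv|exact: cvw].
rewrite -ball_normE /= => good.
have c0 : 0 < `|v| + `|w| + 1 by rewrite ltr_wpDl// addr_ge0.
(* With this step the parallelogram spanned by [h *: v] and [h *: w] at [x] stays in the ball of
   radius [rho]; the added 1 makes the denominator positive and the inclusion strict. *)
set h := rho / (`|v| + `|w| + 1).
have h0 : 0 < h by rewrite divr_gt0.
have small s t : 0 <= s <= h -> 0 <= t <= h -> `|x - (t *: w + (s *: v + x))| < rho.
  move=> /andP[s0 sh] /andP[t0 th].
  rewrite addrA -[X in X - _]add0r opprD addrACA subrr addr0 add0r normrN.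
  rewrite (le_lt_trans (ler_normD _ _))// !normrZ !ger0_norm//.
  apply: (@le_lt_trans _ _ (h * (`|v| + `|w|))).
    by rewrite mulrDr addrC lerD// ler_wpM2r.
  rewrite /h mulrAC ltr_pdivrMr// ltr_pM2l// ltrDl//.
have [s [t [sh th E]]] := @second_difference R V g x v w h (ltW h0) (fun s t sh th =>
  let: And4 a _ b _ := (good _ (small s t sh th)).1 in conj a b).
have small' s' t' : 0 <= s' <= h -> 0 <= t' <= h ->
    `|x - (t' *: v + (s' *: w + x))| < rho.
  by move=> s'h t'h; rewrite addrCA; exact: small.
have [s' [t' [sh' th' E']]] := @second_difference R V g x w v h (ltW h0)
  (fun s t sh th =>
  let: And4 _ a _ b := (good _ (small' s t sh th)).1 in conj a b).
have EE : 'D_w ('D_v g) (t *: w + (s *: v + x)) =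
    'D_v ('D_w g) (t' *: v + (s' *: w + x)).
  apply: (mulIf (x := h ^+ 2)); first by rewrite expf_neq0// gt_eqF.
  apply: etrans (esym E) (etrans _ E').
  by rewrite [h *: v + (h *: w + x)]addrCA; congr (_ + _); exact: addrAC.
have [_ [close1 _]] := good _ (small _ _ sh th).
have [_ [_ close2]] := good _ (small' _ _ sh' th').
move: close1 close2; rewrite EE.
move: ('D_v ('D_w g) (t' *: v + (s' *: w + x))) ('D_w ('D_v g) x) ('D_v ('D_w g) x).
by move=> c a b; exact: dist_le_halves.
Qed.

(** * Coordinates of derivatives and symmetry of the Hessian *)

Section HessianSymmetry.
Context {R : realType} {d : nat}.
Implicit Types (U : set 'cV[R]_d) (g : 'cV[R]_d -> R).

Lemma derivable_coord m n (V : normedModType R) (G : V -> 'M[R]_(m, n)) z v i j :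
  derivable G z v -> derivable (fun y => G y i j) z v.
Proof. by move=> /derivable_mxP. Qed.

Lemma derive_coord m n (V : normedModType R) (G : V -> 'M[R]_(m, n)) z v i j :
  derivable G z v -> 'D_v G z i j = 'D_v (fun y => G y i j) z.
Proof. by move=> /derive_mx ->; rewrite mxE. Qed.

Lemma gradE g i : (fun y => grad g y i 0) = 'D_(basis_vec i) g.
Proof. by apply/funext => y; rewrite mxE. Qed.

Lemma hessianE g x i j : has_partials (grad g) x ->
  hessian g x i j = ('D_(basis_vec j) (grad g) x) i 0.
Proof. by move=> dg; rewrite mxE derive_coord//; exact: dg. Qed.

(** [C2_on] gives continuity of the derivatives of the vector [grad g]; near [x] their coordinates
    are the mixed second derivatives of [g], to which Schwarz's theorem applies. *)
Lemma hessian_sym U g x : open U -> C2_on U g -> U x -> (hessian g x)^T = hessian g x.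
Proof.
move=> oU [[dg _] [dgg cgg]] Ux; apply/matrixP => i j; rewrite !mxE !gradE.
have nU : nbhs x U by exact: open_nbhs_nbhs.
have c k l : {for x, continuous ('D_(basis_vec l) ('D_(basis_vec k) g))}.
  have := cgg l; rewrite continuous_open_subspace// => /(_ x).
  rewrite inE => /(_ Ux) cl.
  apply: (@near_eq_continuous_at _ _ (fun y => 'D_(basis_vec l) (grad g) y k 0)).
    apply: filterS nU => y Uy.
    by rewrite (derive_coord k 0 (dgg _ Uy l)) gradE.
  exact: (cvg_comp _ _ cl (@coord_continuous _ _ _ k 0 _)).
apply: mixed_derivatives_sym; [|exact: c|exact: c].
apply: filterS nU => y Uy; rewrite -!gradE.
split; [exact: dg|exact: dg| |]; apply: derivable_coord; exact: dgg.
Qed.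

End HessianSymmetry.

(** * Implicit functions *)

Section Jacobian.
Context {R : realType} {d : nat}.
Implicit Types (F : 'cV[R]_d -> R -> 'cV[R]_d) (U : set 'cV[R]_d) (I : set R).

(** The vector-valued map is differentiated first and its coordinates taken afterwards, whereas
    [hessian] differentiates coordinates; [jac_grad] reconciles the two. *)
Definition jac F x t : 'M[R]_d := \matrix_(i, j) ('D_(basis_vec j) (F ^~ t) x) i 0.

Lemma jac_basis F x t j : jac F x t *m basis_vec j = 'D_(basis_vec j) (F ^~ t) x.
Proof. by rewrite -colE; apply/colP => i; rewrite !mxE. Qed.

Lemma is_derive_mulmx_sub (G : 'cV[R]_d -> 'cV[R]_d) (A M : 'M[R]_d) z v :
  derivable G z v ->
  is_derive z v (fun y => A *m G y - M *m y) (A *m 'D_v G z - M *m v).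
Proof.
move=> dG; apply/is_derive_cvgP.
have cA : A *m (h^-1 *: (G (h *: v + z) - G z)) @[h --> 0^'] --> A *m 'D_v G z.
  exact: (continuous_cvg _ (@mulmx_continuous _ _ _ A _) dG).
have : A *m (h^-1 *: (G (h *: v + z) - G z)) - M *m v @[h --> 0^'] -->
    A *m 'D_v G z - M *m v.
  by apply: cvgB; [exact: cA|exact: cvg_cst].
apply: cvg_trans; apply: near_eq_cvg.
have := @nbhs_dnbhs_neq R 0; apply: filterS => h h0.
have -> : A *m G (h *: v + z) - M *m (h *: v + z) - (A *m G z - M *m z) =
    A *m (G (h *: v + z) - G z) - h *: (M *m v).
  rewrite mulmxBr mulmxDr -scalemxAr.
  move: (A *m G _) (h *: (M *m v)) (M *m z) (A *m G _) => a b e f.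
  by rewrite opprB addrA opprD addrA subrK addrAC.
by rewrite [RHS]scalerBr scalerA mulVf// scale1r -scalemxAr.
Qed.

(** The scalar inequality is applied to each coordinate of [A G - M]. With [M] the identity it
    measures how far [A G] is from a translation; with [A] the identity and [M] zero it is a
    Lipschitz bound for [G]. *)
Lemma mean_value_jacobian (G : 'cV[R]_d -> 'cV[R]_d) (A M : 'M[R]_d) x0 (r c : R) x y :
  (forall z, `|z - x0| < r -> forall j, derivable G z (basis_vec j) /\
    `|A *m 'D_(basis_vec j) G z - M *m basis_vec j| <= c) ->
  `|x - x0| < r -> `|y - x0| < r -> 0 <= c ->
  `|A *m G x - A *m G y - M *m (x - y)| <= d%:R * c * `|x - y|.
Proof.
move=> dG xr yr c0; apply: normr_mx_le => [|i k]; first by rewrite !mulr_ge0.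
pose g z := (A *m G z - M *m z) i 0.
have dg z v : derivable G z v -> is_derive z v g ((A *m 'D_v G z - M *m v) i 0).
  move=> /(is_derive_mulmx_sub A M) [ex <-]; apply: DeriveDef.
    exact: derivable_coord.
  by rewrite (derive_coord i 0 ex).
have -> : (A *m G x - A *m G y - M *m (x - y)) i k = g x - g y.
  rewrite ord1 /g [in LHS]mulmxBr.
  by move: (A *m G x) (A *m G y) (M *m x) (M *m y) => a b e f; rewrite !mxE; ring.
apply: (mean_value_ball _ xr yr) => z /dG dGz j.
have [ex ->] := dg _ _ (dGz j).1; split; first exact: ex.
by apply: le_trans (normr_entry_le _ _ _) _; exact: (dGz j).2.
Qed.

Lemma derivable_within_lipschitz (W : normedModType R) I (g : R -> W) t :
  derivable_within I g t ->
  exists2 C : R, 0 < C & \forall s \near within I (nbhs t), `|g s - g t| <= C * `|s - t|.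
Proof.
move=> [v gv]; exists (`|v| + 1); first by rewrite ltr_wpDl.
have : \forall s \near within I t^', `|diff_quotient g t s| <= `|v| + 1.
  move/cvgrPdist_lt: gv => /(_ 1 ltr01); apply: filterS => s.
  rewrite distrC => sv; rewrite -(subrK v (diff_quotient g t s)).
  by rewrite (le_trans (ler_normD _ _))// addrC lerD// ltW.
move=> H; apply: (@filterS _ (nbhs t) _ _ _ _ H) => s {}H Is.
have [->|st] := eqVneq s t; first by rewrite !subrr !normr0 mulr0.
have := H st Is; rewrite /diff_quotient normrZ normfV ler_pdivrMl ?normr_gt0 ?subr_eq0//.
by rewrite mulrC.
Qed.

Lemma derivable_within_cvg (W : normedModType R) I (g : R -> W) t :
  derivable_within I g t -> g s @[s --> within I (nbhs t)] --> g t.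
Proof.
move=> /derivable_within_lipschitz[C C0 gC]; apply/cvgrPdist_lt => e e0.
have : \forall s \near within I (nbhs t), `|t - s| < e / C.
  exact/cvg_within/(@near_dist_lt R R^o)/divr_gt0.
apply: filterS2 gC => s gs st.
rewrite distrC (le_lt_trans gs)// distrC mulrC -ltr_pdivlMr//.
Qed.

End Jacobian.

(** * Existence and uniqueness of zeros by contraction *)

Section LocalSolution.
Context {R : realType} {d : nat}.
Variables (U : set 'cV[R]_d) (I : set R) (F : 'cV[R]_d -> R -> 'cV[R]_d).
Hypotheses (openU : open U) (F_C1 : C1_space_time U I F).

Lemma jac_near_inverse x0 t0 (A : 'M[R]_d) (e r0 : R) :
  U x0 -> I t0 -> A *m jac F x0 t0 = 1%:M -> 0 < e -> 0 < r0 ->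
  exists2 r, 0 < r <= r0 & forall x t, I t -> `|x - x0| < r -> `|t - t0| < r ->
    U x /\ forall j, `|A *m 'D_(basis_vec j) (F ^~ t) x - basis_vec j| < e.
Proof.
move=> Ux0 It0 AJ e0 r00.
have [_ _ cD _] := F_C1.
pose Dj j (z : 'cV[R]_d * R) := A *m 'D_(basis_vec j) (F ^~ z.2) z.1.
have near1 j : \forall z \near within (U `*` I) (nbhs (x0, t0)),
    `|Dj j z - basis_vec j| < e.
  have /subspace_continuousP/(_ (x0, t0) (conj Ux0 It0)) cj := cD j.
  have : Dj j z @[z --> within (U `*` I) (nbhs (x0, t0))] --> Dj j (x0, t0).
    exact: (continuous_cvg _ (@mulmx_continuous _ _ _ A _) cj).
  have -> : Dj j (x0, t0) = basis_vec j.
    by rewrite /Dj -[RHS]mul1mx -AJ -mulmxA jac_basis.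
  by move=> /cvgrPdist_lt/(_ e e0); apply: filterS => z; rewrite distrC.
have : \forall z \near within (U `*` I) (nbhs (x0, t0)),
    forall j, `|Dj j z - basis_vec j| < e.
  exact: filter_forall.
move=> /nbhs_ballP[r1 /= r10 good1].
have /nbhs_ballP[r2 /= r20 good2] : nbhs x0 U by exact: open_nbhs_nbhs.
exists (Num.min (Num.min r1 r2) r0).
  by rewrite !lt_min r10 r20 r00 ge_min lexx orbT.
move=> x t It; rewrite !lt_min => /andP[/andP[x1 x2] _] /andP[/andP[t1 _] _].
have Ux : U x by apply: good2; rewrite -ball_normE /= distrC.
split=> // j; apply: (good1 (x, t)) => //.
by split; rewrite /= -ball_normE /= distrC.
Qed.

(** The estimate on differences makes [x - A F(x, t)] a contraction, whence existence and uniqueness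
    of the zero; the one on linear maps makes the Jacobian invertible throughout the ball. *)
Lemma implicit_local x0 t0 (r0 : R) :
  U x0 -> I t0 -> F x0 t0 = 0 -> jac F x0 t0 \in unitmx -> 0 < r0 ->
  let A := invmx (jac F x0 t0) in
  exists r delta, [/\ 0 < r <= r0, 0 < delta,
    forall x, `|x - x0| < r -> U x,
    forall t, I t -> `|t - t0| < delta ->
      (forall x y, `|x - x0| < r -> `|y - x0| < r ->
        `|A *m F x t - A *m F y t - (x - y)| <= 2^-1 * `|x - y|) /\
      (forall (x w : 'cV[R]_d), `|x - x0| < r ->
        `|A *m (jac F x t *m w) - w| <= 2^-1 * `|w|)
    & forall t, I t -> `|t - t0| < delta ->
      exists2 x, `|x - x0| < r & F x t = 0].
Proof.
move=> Ux0 It0 Fx0 uJ r00 A.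
(* The mean value inequality in the sup norm costs a factor [d], and [d%:R * e] is at most one half,
   also for [d = 0]. *)
pose e : R := 2^-1 / d.+1%:R.
have e0 : 0 < e by rewrite divr_gt0.
have de : d%:R * e <= 2^-1.
  by rewrite /e mulrCA ler_piMr// ler_pdivrMr// mul1r ler_nat.
have [r /andP[rpos rr0] good] := jac_near_inverse Ux0 It0 (mulVmx uJ) e0 r00.
have [dF dtF _ _] := F_C1.
have K1 t : I t -> `|t - t0| < r -> forall x y, `|x - x0| < r -> `|y - x0| < r ->
    `|A *m F x t - A *m F y t - (x - y)| <= 2^-1 * `|x - y|.
  move=> It tr x y xr yr; rewrite -[x - y in X in `|X| <= _]mul1mx.
  apply: le_trans (_ : d%:R * e * `|x - y| <= _); last by rewrite ler_wpM2r.
  apply: (mean_value_jacobian (G := F ^~ t) (r := r) (x0 := x0)) => //; last exact: ltW.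
  move=> z zr j; have [Uz Dz] := good z t It zr tr.
  by split; [exact: dF|rewrite mul1mx ltW].
have K2 t : I t -> `|t - t0| < r -> forall x (w : 'cV[R]_d), `|x - x0| < r ->
    `|A *m (jac F x t *m w) - w| <= 2^-1 * `|w|.
  move=> It tr x w xr; rewrite mulmxA -[X in _ - X]mul1mx -mulmxBl.
  apply: le_trans (_ : d%:R * e * `|w| <= _); last by rewrite ler_wpM2r.
  apply: normr_mulmx_basis_le => j.
  have [_ Dx] := good x t It xr tr.
  by rewrite mulmxBl mul1mx -mulmxA jac_basis ltW.
(* The centre moves by less than [r / 4], and a point at distance at most [r / 2] adds at most
   [r / 4] by contraction: the closed ball of radius [r / 2] is mapped into itself. *)
have /nbhs_ballP[delta0 /= d00 small] : \forall t \near t0, I t ->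
    `|A *m F x0 t| < r / 4.
  have : A *m F x0 t @[t --> within I (nbhs t0)] --> A *m F x0 t0.
    apply: (continuous_cvg _ (@mulmx_continuous _ _ _ A _)).
    exact: (derivable_within_cvg (dtF x0 t0 Ux0 It0)).
  move=> /cvgrPdist_lt/(_ (r / 4)); rewrite Fx0 mulmx0 => H.
  have r4 : 0 < r / 4 by rewrite divr_gt0.
  apply: (@filterS _ (nbhs t0) _ _ _ _ (H r4)) => t + It.
  by move=> /(_ It); rewrite sub0r normrN.
exists r, (Num.min r delta0); split.
- by rewrite rpos.
- by rewrite lt_min rpos.
- move=> x xr; have tr0 : `|t0 - t0| < r by rewrite subrr normr0.
  by have [] := good x t0 It0 xr tr0.
- by move=> t It; rewrite lt_min => /andP[tr _]; split; [exact: K1|exact: K2].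
move=> t It; rewrite lt_min => /andP[tr td].
have smallt : `|A *m F x0 t| < r / 4.
  by apply: small => //; rewrite -ball_normE /= distrC.
(* The fixed point theorem asks for a closed set; half the radius keeps it inside the open ball of
   the estimates. *)
pose B := closed_ball_ Num.norm x0 (r / 2).
pose T x := x - A *m F x t.
have BE x : B x -> `|x - x0| < r.
  rewrite /B /closed_ball_ /= distrC => /le_lt_trans; apply.
  by rewrite ltr_pdivrMr// ltr_pMr// ltr1n.
have Tlip x y : `|x - x0| < r -> `|y - x0| < r -> `|T x - T y| <= 2^-1 * `|x - y|.
  move=> xr yr; rewrite (le_trans _ (K1 t It tr x y xr yr))// /T distrC.
  rewrite le_eqVlt; apply/orP; left; apply/eqP; congr (`|_|).
  move: (A *m F x t) (A *m F y t) => a b.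
  by rewrite !opprB [RHS]addrC addrACA [RHS]addrACA [- b - x]addrC.
have x0r : `|x0 - x0| < r by rewrite subrr normr0.
have TB : set_fun B B T.
  move=> x Bx; rewrite /B /closed_ball_/= distrC.
  rewrite -(subrKA (T x0)) (le_trans (ler_normD _ _))//.
  have -> : r / 2 = r / 4 + r / 4 by field.
  apply: lerD.
    apply: le_trans (Tlip _ _ (BE _ Bx) x0r) _.
    have : `|x - x0| <= r / 2 by rewrite distrC.
    lra.
  by rewrite /T addrC addKr normrN ltW.
have contr : is_contraction (mkfun_fun TB).
  exists (2^-1)%:nng; split; first by rewrite /= invf_lt1// ltr1n.
  by move=> [x y] [/= /BE xr /BE yr]; exact: Tlip.
have Bx0 : B x0 by rewrite /B /closed_ball_ /= subrr normr0 divr_ge0// ltW.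
have [p Bp pE] := banach_fixed_point contr (@closed_closed_ball_ _ _ x0 (r / 2))
  (ex_intro _ x0 Bx0).
exists p; first exact: BE.
have /eqP : p = p - A *m F p t by exact: pE.
rewrite -subr_eq0 opprB addrC subrK => /eqP AF.
by rewrite -[F p t](mulKVmx uJ) AF mulmx0.
Qed.

End LocalSolution.

(** * Derivatives relative to an interval *)

Section WithinDerivatives.
Context {R : realType} {W : normedModType R}.
Implicit Types (I J : set R) (g : R -> W).

Lemma has_derive_within_lim I g t :
  derivable_within I g t -> has_derive_within I g t (derive_within I g t).
Proof. by move=> [v gv]; exact: (getPex (ex_intro _ v gv)). Qed.

Lemma has_derive_within_subset I J g t v : J `<=` I ->
  has_derive_within I g t v -> has_derive_within J g t v.
Proof.
move=> JI gv; apply: cvg_trans gv => P PI.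
by apply: (@filterS _ (nbhs t) _ _ _ _ PI) => s Ps st /JI; exact: Ps.
Qed.

(** A second point of the interval gives points of it arbitrarily close to [t], by moving a small
    fraction [th] of the way to [s]. Properness makes one-sided derivatives at end points unique
    too. *)
Lemma interval_dnbhs_proper J t s : is_interval J -> J t -> J s -> s != t ->
  ProperFilter (within J t^').
Proof.
move=> iJ Jt Js st; apply: Build_ProperFilter_ex => P /nbhs_ballP[e /= e0 eP].
pose th := Num.min 1 (e / (2 * `|s - t|)).
have d0 : 0 < `|s - t| by rewrite normr_gt0 subr_eq0.
have th0 : 0 < th by rewrite lt_min ltr01 divr_gt0// mulr_gt0.
have th1 : th <= 1 by rewrite ge_min lexx.
exists (t + th * (s - t)); apply: eP.
- rewrite -ball_normE /= opprD addrA subrr add0r normrN normrM (gtr0_norm th0).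
  rewrite (@le_lt_trans _ _ (e / (2 * `|s - t|) * `|s - t|))//.
    by rewrite ler_wpM2r// ge_min lexx orbT.
  rewrite invfM mulrA divfK ?gt_eqF// ltr_pdivrMr// ltr_pMr// ltr1n//.
- by rewrite /= -[X in _ != X]addr0 (inj_eq (addrI _)) mulf_eq0 negb_or gt_eqF//= subr_eq0.
have [ts|ts] := leP t s.
  by apply: (iJ t s) => //; apply/andP; split; nra.
by apply: (iJ s t) => //; apply/andP; split; nra.
Qed.

Lemma has_derive_within_unique J g t s v : is_interval J -> J t -> J s -> s != t ->
  has_derive_within J g t v -> derive_within J g t = v.
Proof.
move=> iJ Jt Js st gv; have pf := interval_dnbhs_proper iJ Jt Js st.
exact: cvg_lim gv.
Qed.

End WithinDerivatives.

Lemma unitmx_inj (K : fieldType) n (M : 'M[K]_n) :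
  (forall w : 'cV[K]_n, M *m w = 0 -> w = 0) -> M \in unitmx.
Proof.
move=> Minj; rewrite -unitmx_tr -row_free_unit -kermx_eq0; apply/rowV0P => v.
move=> /sub_kermxP vM; apply: trmx_inj; rewrite trmx0; apply: Minj.
by rewrite -[M]trmxK -trmx_mul vM trmx0.
Qed.

(** This inverts the near-identity estimates: when [y] is the image of [w] under such a map, it
    controls [w]. *)
Lemma half_contraction_le (R : realFieldType) (V : normedZmodType R) (w y : V) :
  `|y - w| <= 2^-1 * `|w| -> `|w| <= 2 * `|y|.
Proof.
move=> yw; have := ler_normB y (y - w); rewrite subKr => h.
have h2 : `|w| <= `|y| + 2^-1 * `|w| by exact: le_trans h (lerD (lexx _) yw).
lra.
Qed.

(** * Differentiability of a curve of zeros *)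

Section ZeroCurve.
Context {R : realType} {d : nat}.
Variables (U : set 'cV[R]_d) (I J : set R) (F : 'cV[R]_d -> R -> 'cV[R]_d).
Hypotheses (openU : open U) (F_C1 : C1_space_time U I F) (JI : J `<=` I).
Variables (A : 'M[R]_d) (m : R -> 'cV[R]_d).
Hypotheses (mU : forall t, J t -> U (m t)) (Fm : forall t, J t -> F (m t) t = 0).
Hypothesis AF : forall s t, J s -> J t ->
  `|A *m F (m s) s - A *m F (m t) s - (m s - m t)| <= 2^-1 * `|m s - m t|.
Hypothesis AJ : forall s (w : 'cV[R]_d), J s ->
  `|A *m (jac F (m s) s *m w) - w| <= 2^-1 * `|w|.

Definition velocity t := - (invmx (jac F (m t) t) *m derive_within I (F (m t)) t).

Lemma jac_unit t : J t -> jac F (m t) t \in unitmx.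
Proof.
move=> Jt; apply: unitmx_inj => w Jw; have := AJ w Jt; rewrite Jw mulmx0 sub0r normrN.
move=> w2; apply/eqP; rewrite -normr_le0; lra.
Qed.

(** Since [F (m s) s] vanishes, [AF] bounds [m s - m t] by twice the norm of [A *m F (m t) s], and
    [F (m t)] is differentiable in time and zero at [t]. *)
Lemma zero_curve_lipschitz t : J t ->
  exists2 L : R, 0 < L & \forall s \near within J (nbhs t), `|m s - m t| <= L * `|s - t|.
Proof.
move=> Jt; have [_ dtF _ _] := F_C1.
have [C C0 FC] := derivable_within_lipschitz (dtF _ _ (mU Jt) (JI Jt)).
exists (2 * (d%:R * `|A| + 1) * C).
  by rewrite !mulr_gt0// ltr_wpDl// mulr_ge0.
apply: (@filterS _ (nbhs t) _ _ _ _ FC) => s Fs Js.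
have := AF Js Jt; rewrite (Fm Js) mulmx0 sub0r => /half_contraction_le.
move=> /le_trans; apply; rewrite -!mulrA ler_pM2l//.
rewrite normrN (le_trans (normr_mulmx_le _ _))//.
apply: ler_pM; rewrite ?mulr_ge0// ?lerDl//.
by have := Fs (JI Js); rewrite (Fm Jt) subr0.
Qed.

(** With [A'] the inverse of the Jacobian at [m t] itself, [A' F(., s)] differs from a translation
    by an arbitrarily small Lipschitz error. As [F (m s) s] is zero, [m s - m t] is then close to
    [- A' F(m t, s)], and the Lipschitz bound on [m] makes the error small relative to [s - t]. *)
Lemma zero_curve_derive t : J t -> has_derive_within J m t (velocity t).
Proof.
move=> Jt; have [dF dtF _ _] := F_C1.
have [L L0 mL] := zero_curve_lipschitz Jt.
set A' := invmx (jac F (m t) t).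
have pb := has_derive_within_subset JI
  (has_derive_within_lim (dtF _ _ (mU Jt) (JI Jt))).
have Apb : A' *m diff_quotient (F (m t)) t s @[s --> within J t^'] -->
    A' *m derive_within I (F (m t)) t.
  exact: (continuous_cvg _ (@mulmx_continuous _ _ _ A' _) pb).
apply/cvgrPdist_lt => e e0.
(* The denominator absorbs the dimension factor of the mean value inequality and the Lipschitz
   constant of the curve; the other [e / 2] is for the difference quotient in time. *)
pose e' := e / 2 / (d.+1%:R * L).
have e'0 : 0 < e' by rewrite !divr_gt0// mulr_gt0.
have e20 : 0 < e / 2 by rewrite divr_gt0.
have [r /andP[r0 _] good] :=
  jac_near_inverse openU F_C1 (mU Jt) (JI Jt) (mulVmx (jac_unit Jt)) e'0 ltr01.
(* Within time [r / L] the Lipschitz bound keeps [m s] in the ball of radius [r] about [m t]. *)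
have rL0 : 0 < Num.min r (r / L) by rewrite lt_min r0 divr_gt0.
have near_r : \forall s \near within J t^', `|t - s| < Num.min r (r / L).
  by apply: cvg_within; apply: cvg_within; exact: (@near_dist_lt R R^o).
have mL' : \forall s \near within J t^', `|m s - m t| <= L * `|s - t|.
  by apply: (@filterS _ (nbhs t) _ _ _ _ mL) => s ms _.
have Js : \forall s \near within J t^', J s by exact: withinT.
have nst : \forall s \near within J t^', s != t.
  by apply: (@filterE _ (nbhs t)) => s st _.
have Ap : \forall s \near within J t^',
    `|A' *m derive_within I (F (m t)) t - A' *m diff_quotient (F (m t)) t s| < e / 2.
  by move/cvgrPdist_lt: Apb; apply.
near=> s.
have js : J s by near: s.
have st : s != t by near: s.
have ms : `|m s - m t| <= L * `|s - t| by near: s.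
have Aps : `|A' *m derive_within I (F (m t)) t -
    A' *m diff_quotient (F (m t)) t s| < e / 2.
  by near: s.
have : `|t - s| < Num.min r (r / L) by near: s.
rewrite lt_min distrC => /andP[sr]; rewrite ltr_pdivlMr// mulrC => sL.
have msr : `|m s - m t| < r := le_lt_trans ms sL.
have mtr : `|m t - m t| < r by rewrite subrr normr0.
have est : `|A' *m F (m s) s - A' *m F (m t) s - 1%:M *m (m s - m t)| <=
    d%:R * e' * `|m s - m t|.
  apply: (mean_value_jacobian (G := F ^~ s) _ msr mtr (ltW e'0)) => z zr j.
  have [Uz Dz] := good z s (JI js) zr sr.
  by split; [exact: (dF _ _ Uz (JI js))|rewrite mul1mx; exact: ltW (Dz j)].
have {est} est : `|A' *m F (m t) s + (m s - m t)| <= e / 2 * `|s - t|.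
  move: est; rewrite (Fm js) mulmx0 sub0r mul1mx -opprD normrN => /le_trans; apply.
  have e'E : e' * (d.+1%:R * L) = e / 2 by rewrite divfK// gt_eqF// mulr_gt0.
  rewrite -e'E; apply: (@le_trans _ _ (d%:R * e' * (L * `|s - t|))).
    by rewrite ler_wpM2l// mulr_ge0// ltW.
  rewrite mulrA ler_wpM2r// -mulrA mulrCA ler_pM2l// ler_pM2r//.
  by rewrite ler_nat.
have {est} est : `|A' *m diff_quotient (F (m t)) t s + diff_quotient m t s| <= e / 2.
  rewrite /diff_quotient (Fm Jt) subr0 -scalemxAr -scalerDr normrZ normfV.
  by rewrite ler_pdivrMl ?normr_gt0 ?subr_eq0// mulrC.
rewrite /velocity -/A' -opprD normrN.
move: Aps est; move: (A' *m diff_quotient _ _ _) (A' *m _) (diff_quotient m t s).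
move=> a b q ba aq; rewrite -(subrKA a) [e]splitr.
by apply: le_lt_trans (ler_normD _ _) _; exact: ltr_leD.
Unshelve. all: by end_near. Qed.


End ZeroCurve.

Section ZeroCurveC1.
Context {R : realType} {d : nat}.
Variables (U : set 'cV[R]_d) (I J : set R) (F : 'cV[R]_d -> R -> 'cV[R]_d).
Hypotheses (openU : open U) (F_C1 : C1_space_time U I F) (JI : J `<=` I).
Variables (A : 'M[R]_d) (m : R -> 'cV[R]_d).
Hypotheses (mU : forall t, J t -> U (m t)) (Fm : forall t, J t -> F (m t) t = 0).
Hypothesis AF : forall s t : R, J s -> J t ->
  `|A *m F (m s) s - A *m F (m t) s - (m s - m t)| <= 2^-1 * `|m s - m t|.
Hypothesis AJ : forall s (w : 'cV[R]_d), J s ->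
  `|A *m (jac F (m s) s *m w) - w| <= 2^-1 * `|w|.

Let mder := zero_curve_derive openU F_C1 JI mU Fm AF AJ.

Lemma zero_curve_graph_cvg t : J t ->
  (m s, s) @[s --> within J (nbhs t)] --> within (U `*` I) (nbhs (m t, t)).
Proof.
move=> Jt.
have ct : (m s, s) @[s --> within J (nbhs t)] --> (m t, t).
  have c2 : s @[s --> within J (nbhs t)] --> t by exact: cvg_within.
  exact: (cvg_pair (derivable_within_cvg (ex_intro _ _ (mder Jt))) c2).
move=> P /ct; apply: (@filterS _ (nbhs t)) => s Ps Js; apply: Ps => //.
by split; [exact: mU|exact: JI].
Qed.

Lemma zero_curve_comp_cvg (W : topologicalType) (G : 'cV[R]_d * R -> W) t : J t ->
  {within U `*` I, continuous G} ->
  G (m s, s) @[s --> within J (nbhs t)] --> G (m t, t).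
Proof.
move=> Jt /subspace_continuousP/(_ (m t, t) (conj (mU Jt) (JI Jt))) cG.
exact: cvg_comp (zero_curve_graph_cvg Jt) cG.
Qed.

(** The velocity solves a linear equation with the Jacobian as its matrix. The velocity [w] at [t],
    put into the equation at [s], leaves a residual [y s] that tends to zero, and by [AJ] the
    distance from [w] to the solution at [s] is at most twice that residual. *)
Lemma velocity_cvg t : J t ->
  velocity I F m s @[s --> within J (nbhs t)] --> velocity I F m t.
Proof.
move=> Jt; have [_ _ cD cdt] := F_C1; set w := velocity I F m t.
pose y s := A *m (- derive_within I (F (m s)) s - jac F (m s) s *m w).
have jacw s : J s -> jac F (m s) s *m velocity I F m s = - derive_within I (F (m s)) s.
  by move=> Js; rewrite /velocity mulmxN mulKVmx//; exact: jac_unit AJ _ Js.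
have cjac : jac F (m s) s *m w @[s --> within J (nbhs t)] --> jac F (m t) t *m w.
  have jE s : jac F (m s) s *m w = \sum_j w j 0 *: 'D_(basis_vec j) (F ^~ s) (m s).
    rewrite {1}[w]cV_sum_basis mulmx_sumr; apply: eq_bigr => j _.
    by rewrite -scalemxAr jac_basis.
  have -> : (fun s => jac F (m s) s *m w) =
      fun s => \sum_j w j 0 *: 'D_(basis_vec j) (F ^~ s) (m s) by exact/funext.
  rewrite jE.
  apply: cvg_big => [|j _]; first exact: add_continuous.
  by apply: cvgZ; [exact: cvg_cst|exact: (zero_curve_comp_cvg Jt (cD j))].
have cb : derive_within I (F (m s)) s @[s --> within J (nbhs t)] -->
    derive_within I (F (m t)) t.
  exact: (zero_curve_comp_cvg Jt cdt).
have cy : y s @[s --> within J (nbhs t)] --> y t.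
  apply: (continuous_cvg _ (@mulmx_continuous _ _ _ A _)).
  exact: (cvgB (cvgN cb) cjac).
have y0 : y t = 0 by rewrite /y jacw// subrr mulmx0.
apply/cvgrPdist_lt => e e0.
have e20 : 0 < e / 2 by rewrite divr_gt0.
move/cvgrPdist_lt: cy => /(_ _ e20); rewrite y0; near_simpl.
apply: (@filterS _ (nbhs t)) => s ys Js; move: (ys Js).
rewrite sub0r normrN distrC => {}ys.
have yE : A *m (jac F (m s) s *m (velocity I F m s - w)) = y s.
  by rewrite /y -(jacw _ Js) mulmxBr.
have := AJ (velocity I F m s - w) Js; rewrite yE.
move=> /half_contraction_le/le_lt_trans; apply; lra.
Qed.

Lemma zero_curve_C1 : is_interval J ->
  {within J, continuous (derive_within J m)}.
Proof.
move=> iJ; apply/subspace_continuousP => t Jt; apply/cvgrPdist_lt => e e0.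
(* On a one-point interval [derive_within] is a limit along a trivial filter, but continuity is
   immediate; otherwise derivatives are unique and equal to [velocity]. *)
have [[s [Js st]]|Jsing] := pselect (exists s, J s /\ s != t); last first.
  apply: (@filterE _ (nbhs t)) => s Js.
  have -> : s = t.
    by apply/eqP/negPn/negP => st; apply: Jsing; exists s.
  by rewrite subrr normr0.
have vE u : J u -> derive_within J m u = velocity I F m u.
  move=> Ju; have [tu|tu] := eqVneq t u.
    by apply: (has_derive_within_unique iJ Ju Js) (mder Ju); rewrite -tu.
  exact: has_derive_within_unique iJ Ju Jt tu (mder Ju).
have := velocity_cvg Jt; move/cvgrPdist_lt => /(_ _ e0).
by apply: (@filterS _ (nbhs t)) => u vu Ju;
  rewrite /from_subspace (vE _ Jt) (vE _ Ju); exact: vu.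
Qed.

End ZeroCurveC1.

(** * Joint continuity in space and time *)

Section JointContinuity.
Context {R : realType} {d : nat}.
Variables (U : set 'cV[R]_d) (I : set R) (F : 'cV[R]_d -> R -> 'cV[R]_d).
Hypotheses (openU : open U) (F_C1 : C1_space_time U I F).

Lemma jac_near x t (e : R) : U x -> I t -> 0 < e ->
  \forall z \near within (U `*` I) (nbhs (x, t)),
    forall i j, `|jac F z.1 z.2 i j - jac F x t i j| <= e.
Proof.
move=> Ux It e0; have [_ _ cD _] := F_C1.
have near1 j : \forall z \near within (U `*` I) (nbhs (x, t)),
    forall i, `|jac F z.1 z.2 i j - jac F x t i j| <= e.
  have /subspace_continuousP/(_ (x, t) (conj Ux It)) cj := cD j.
  move/cvgrPdist_le : cj => /(_ e e0); apply: filterS => z ze i.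
  rewrite distrC; apply: le_trans ze.
  have := normr_entry_le ('D_(basis_vec j) (F ^~ t) x -
    'D_(basis_vec j) (F ^~ z.2) z.1) i 0.
  by rewrite !mxE.
have : \forall z \near within (U `*` I) (nbhs (x, t)),
    forall j i, `|jac F z.1 z.2 i j - jac F x t i j| <= e.
  exact: filter_forall.
by apply: filterS => z H i j; exact: H.
Qed.

(** [C1_space_time] asserts joint continuity of the derivatives only. For [F] itself, the space
    derivatives are bounded near the point, which controls a move in space uniformly in time, and
    differentiability in time at [x] controls the rest. *)
Lemma C1_joint_cvg x t : U x -> I t ->
  F z.1 z.2 @[z --> within (U `*` I) (nbhs (x, t))] --> F x t.
Proof.
move=> Ux It; have [dF dtF cD _] := F_C1.
pose c : R := \big[Num.max/0]_j `|'D_(basis_vec j) (F ^~ t) x| + 1.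
have cj j : `|'D_(basis_vec j) (F ^~ t) x| + 1 <= c.
  by rewrite lerD2r; exact: (le_bigmax _ (fun j => `|'D_(basis_vec j) (F ^~ t) x|)).
have c0 : 0 < c by rewrite ltr_wpDl//; exact: bigmax_ge_id.
have near1 j : \forall z \near within (U `*` I) (nbhs (x, t)),
    `|'D_(basis_vec j) (F ^~ z.2) z.1| <= c.
  have /subspace_continuousP/(_ (x, t) (conj Ux It)) := cD j.
  move/cvgrPdist_le => /(_ 1 ltr01); apply: filterS => z /= z1.
  apply: le_trans (cj j).
  rewrite -(subrK ('D_(basis_vec j) (F ^~ t) x) ('D_(basis_vec j) (F ^~ z.2) z.1)).
  apply: le_trans (ler_normD _ _) _; rewrite addrC distrC.
  exact: lerD (lexx _) z1.
have : \forall z \near within (U `*` I) (nbhs (x, t)),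
    forall j, `|'D_(basis_vec j) (F ^~ z.2) z.1| <= c.
  exact: filter_forall.
move=> /nbhs_ballP[r1 /= r10 good1].
have /nbhs_ballP[r2 /= r20 good2] : nbhs x U by exact: open_nbhs_nbhs.
pose r := Num.min r1 r2.
have r0 : 0 < r by rewrite lt_min r10.
apply/cvgrPdist_lt => e e0.
have e20 : 0 < e / 2 by rewrite divr_gt0.
have dc0 : 0 < d.+1%:R * c by rewrite mulr_gt0.
have e'0 : 0 < Num.min r (e / 2 / (d.+1%:R * c)) by rewrite lt_min r0 divr_gt0.
have /nbhs_ballP[r3 /= r30 good3] : \forall s \near t, I s -> `|F x t - F x s| < e / 2.
  by have := derivable_within_cvg (dtF x t Ux It); move/cvgrPdist_lt => /(_ _ e20).
have r40 : 0 < Num.min (Num.min r (e / 2 / (d.+1%:R * c))) r3 by rewrite lt_min e'0.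
apply/nbhs_ballP; exists (Num.min (Num.min r (e / 2 / (d.+1%:R * c))) r3) => //=.
move=> [z s] [/=]; rewrite -!ball_normE /= !lt_min.
move=> /andP[/andP[/andP[zr1 zr2] ze] _] /andP[/andP[/andP[sr1 sr2] _] s3] [/= Uz Is].
apply: le_lt_trans (ler_distD (F x s) _ _) _; rewrite [e]splitr.
apply: ltr_leD; first by apply: good3; rewrite -?ball_normE.
have xr : `|x - x| < r by rewrite subrr normr0.
have zr : `|z - x| < r by rewrite distrC lt_min zr1.
apply: (@le_trans _ _ (d%:R * c * `|x - z|)).
  have := @mean_value_jacobian _ _ (F ^~ s) 1%:M 0 x r c x z _ xr zr (ltW c0).
  rewrite !mul1mx mul0mx subr0; apply => y; rewrite lt_min => /andP[yr1 yr2] j.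
  have Uy : U y by apply: good2; rewrite -ball_normE /= distrC.
  split; first exact: dF.
  rewrite mul1mx mul0mx subr0; apply: (good1 (y, s)) => //.
  by split; rewrite /= -ball_normE //= distrC.
rewrite ltr_pdivlMr// mulrC in ze; apply: le_trans (ltW ze).
by rewrite ler_wpM2r// ler_pM2r// ler_nat.
Qed.

End JointContinuity.

(** * The implicit curve over a time interval *)

Section ImplicitCurve.
Context {R : realType} {d : nat}.
Implicit Types (U : set 'cV[R]_d) (I J : set R) (F : 'cV[R]_d -> R -> 'cV[R]_d).

Lemma subinterval_nbhs_near I J t0 (P : set R) : subinterval_nbhs I t0 J ->
  (\forall s \near within J (nbhs t0), P s) -> \forall s \near within I (nbhs t0), P s.
Proof.
move=> [_ Jt0 [B oB JB]] PJ.
have Bt0 : nbhs t0 B by apply: open_nbhs_nbhs; split=> //; move: Jt0; rewrite JB => -[].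
apply: (@filterS _ (nbhs t0) _ _ _ _ (filterI Bt0 PJ)) => s [Bs Ps] Is.
by apply: Ps; rewrite JB.
Qed.

Lemma is_interval_ball I (t0 e : R) : is_interval I ->
  is_interval (ball t0 e `&` I).
Proof.
rewrite -ball_normE => iI a b [/= ta Ia] [/= tb Ib] c /andP[ac cb].
split; last by apply: (iI a b) => //; rewrite ac cb.
by move: ta tb; rewrite /= !ltr_norml => /andP[a1 a2] /andP[b1 b2];
  apply/andP; split; lra.
Qed.

Lemma subinterval_nbhs_shrink I J t0 (P : set R) : is_interval I ->
  subinterval_nbhs I t0 J -> (\forall s \near within J (nbhs t0), P s) ->
  exists J', [/\ subinterval_nbhs I t0 J', J' `<=` J & J' `<=` P].
Proof.
move=> iI [iJ Jt0 [B oB JB]] /nbhs_ballP[e /= e0 eP].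
exists (ball t0 e `&` J); split.
- split; [exact: is_interval_ball|by split=> //; exact: ballxx|].
  exists (ball t0 e `&` B); last by rewrite JB setIA.
  by apply: openI => //; exact: ball_open.
- by move=> s [].
- by move=> s [/eP]; exact.
Qed.

(** The radius [r] is that of a ball in which the zero is unique at each time of [J]. The
    convergence of the graph in the last clause transports facts near [(x0, t0)] to the curve, such
    as closeness of Hessians. *)
Definition implicit_curve_at U I F x0 t0 r J (m : R -> 'cV[R]_d) : Prop :=
  [/\ 0 < r, forall x, `|x - x0| < r -> U x, subinterval_nbhs I t0 J, m t0 = x0 &
   [/\ forall t, J t -> `|m t - x0| < r /\ F (m t) t = 0,
       forall t x, J t -> `|x - x0| < r -> F x t = 0 -> x = m t,
       forall t, J t -> jac F (m t) t \in unitmx,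
       forall t, J t -> has_derive_within J m t (velocity I F m t)
     & {within J, continuous (derive_within J m)} /\
       (m s, s) @[s --> within J (nbhs t0)] --> within (U `*` I) (nbhs (x0, t0))]].

Lemma implicit_curve U I F x0 t0 (r0 : R) :
  open U -> is_interval I -> C1_space_time U I F ->
  U x0 -> I t0 -> F x0 t0 = 0 -> jac F x0 t0 \in unitmx -> 0 < r0 ->
  exists r J m, r <= r0 /\ implicit_curve_at U I F x0 t0 r J m.
Proof.
move=> oU iI F_C1 Ux0 It0 F0 uJ r00.
have [r [delta [/andP[rpos rr0] d0 rU K12 K3]]] :=
  implicit_local oU F_C1 Ux0 It0 F0 uJ r00.
set A := invmx (jac F x0 t0) in K12.
pose J := ball t0 delta `&` I.
have Jd t : J t -> I t /\ `|t - t0| < delta.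
  by move=> [+ It]; rewrite -ball_normE /= distrC.
have JI : J `<=` I by move=> t [].
have Jt0 : J t0 by split=> //; exact: ballxx.
(* Placing [J t] under the existential lets [choice] produce a total function, arbitrary outside
   [J]. *)
have ex t : exists x, J t -> `|x - x0| < r /\ F x t = 0.
  have [/Jd[It td]|nJ] := pselect (J t); last by exists 0.
  by have [x xr Fx] := K3 t It td; exists x.
have [m mE] := choice ex.
have uniq t x : J t -> `|x - x0| < r -> F x t = 0 -> x = m t.
  move=> Jt xr Fx; have [mr Fm] := mE t Jt; have [It td] := Jd t Jt.
  have [K _] := K12 t It td; have := K x (m t) xr mr.
  rewrite Fx Fm subrr sub0r normrN => h; apply/eqP; rewrite -subr_eq0 -normr_le0.
  lra.
have mt0 : m t0 = x0 by apply/esym/uniq => //; rewrite subrr normr0.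
have mU t : J t -> U (m t) by move=> /mE[/rU].
have Fm t : J t -> F (m t) t = 0 by move=> /mE[].
have AF s t : J s -> J t ->
    `|A *m F (m s) s - A *m F (m t) s - (m s - m t)| <= 2^-1 * `|m s - m t|.
  move=> Js Jt; have [Is sd] := Jd s Js; have [K _] := K12 s Is sd.
  by apply: K; [have [] := mE s Js|have [] := mE t Jt].
have AJ s (w : 'cV[R]_d) : J s -> `|A *m (jac F (m s) s *m w) - w| <= 2^-1 * `|w|.
  move=> Js; have [Is sd] := Jd s Js; have [_ K] := K12 s Is sd.
  by apply: K; have [] := mE s Js.
have iJ : is_interval J by exact: is_interval_ball.
have mder := zero_curve_derive oU F_C1 JI mU Fm AF AJ.
exists r, J, m; split; first exact: rr0.
split; [exact: rpos|exact: rU| |exact: mt0|].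
  by split; [exact: iJ|exact: Jt0|exists (ball t0 delta); [exact: ball_open|]].
split; [exact: mE|exact: uniq| |exact: mder|].
  by move=> t Jt; exact: (jac_unit AJ Jt).
split; first exact: (zero_curve_C1 oU F_C1 JI mU Fm AF AJ iJ).
by have := zero_curve_graph_cvg oU F_C1 JI mU Fm AF AJ Jt0; rewrite mt0.
Qed.

End ImplicitCurve.

(** * Critical points of a family *)

Section CriticalPointsOfFamily.
Context {R : realType} {d : nat}.
Variables (U : set 'cV[R]_d) (I : set R) (f : 'cV[R]_d -> R -> R).
Hypotheses (openU : open U) (intervalI : is_interval I)
  (f_C2_x : forall t, I t -> C2_on U (f ^~ t))
  (grad_C1 : C1_space_time U I (fun x t => grad (f ^~ t) x)).

Local Notation F := (fun x t => grad (f ^~ t) x).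

Lemma jac_grad x t : U x -> I t -> jac F x t = hessian (f ^~ t) x.
Proof.
move=> Ux It; have [dF _ _ _] := grad_C1; apply/matrixP => i j.
by rewrite (hessianE i j (dF x t Ux It)) mxE.
Qed.

Lemma hessian_near x t (e : R) : U x -> I t -> 0 < e ->
  \forall z \near within (U `*` I) (nbhs (x, t)),
    forall i j, `|hessian (f ^~ z.2) z.1 i j - hessian (f ^~ t) x i j| <= e.
Proof.
move=> Ux It e0; have nz := jac_near grad_C1 Ux It e0.
apply: (@filterS _ (nbhs (x, t)) _ _ _ _ nz) => z nzz [Uz Iz] i j.
by have := nzz (conj Uz Iz) i j; rewrite jac_grad// jac_grad.
Qed.

Hypothesis f_mixed : mixed_derivatives_commute U I f.

Lemma implicit_curve_critical x0 t0 r J m :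
  implicit_curve_at U I F x0 t0 r J m ->
  [/\ [/\ open (ball x0 r), ball x0 r x0 & ball x0 r `<=` U],
      subinterval_nbhs I t0 J, critical_curve f x0 t0 J (ball x0 r) m &
      forall m', critical_curve f x0 t0 J (ball x0 r) m' -> forall t, J t -> m' t = m t].
Proof.
move=> [r0 rU Jnbhs mt0 [mF uniq _ mder [cder _]]].
have ballE x : ball x0 r x = (`|x - x0| < r) :> Prop by rewrite -ball_normE /= distrC.
split.
- split; [exact: ball_open|exact: ballxx|move=> x].
  by rewrite ballE; exact: rU.
- exact: Jnbhs.
- split; [split|exact: mt0|by move=> t /mF[]].
  + by move=> t /mF[]; rewrite ballE.
  + by move=> t Jt; exists (velocity I F m t); exact: mder.
  + exact: cder.
move=> m' [[m'V _ _] _ m'F] t Jt; apply: uniq => //; last exact: m'F.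
by rewrite -ballE; exact: m'V.
Qed.

Lemma implicit_curve_velocity x0 t0 r J m :
  implicit_curve_at U I F x0 t0 r J m -> forall t, J t ->
  nondegenerate_at (f ^~ t) (m t) /\
  has_derive_within J m t
    (- (invmx (hessian (f ^~ t) (m t)) *m grad (dt I f ^~ t) (m t))).
Proof.
move=> [r0 rU [_ _ [B _ JB]] _ [mF _ uJ mder _]] t Jt.
have It : I t by move: Jt; rewrite JB => -[].
have Umt : U (m t) by have [/rU] := mF t Jt.
rewrite /nondegenerate_at -(jac_grad Umt It); split; first exact: uJ.
have [_ <-] := f_mixed Umt It; exact: mder.
Qed.

Lemma implicit_curve_local_modes x0 t0 r J m : U x0 -> I t0 ->
  implicit_curve_at U I F x0 t0 r J m -> negative_definite (hessian (f ^~ t0) x0) ->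
  exists J' : set R, [/\ subinterval_nbhs I t0 J', J' `<=` J
    & forall t, J' t -> local_mode (f ^~ t) (m t)].
Proof.
move=> Ux0 It0 [r0 rU Jn _ [mF _ _ _ [_ mcvg]]] nH.
have [e e0 He] := negative_definite_stable (hessian_sym openU (f_C2_x It0) Ux0) nH.
have near_e : \forall s \near within J (nbhs t0), forall i j,
    `|hessian (f ^~ s) (m s) i j - hessian (f ^~ t0) x0 i j| <= e.
  exact: (mcvg _ (hessian_near Ux0 It0 e0)).
have [J' [J'n J'J J'P]] := subinterval_nbhs_shrink intervalI Jn near_e.
exists J'; split; [exact: J'n|exact: J'J|move=> t J't].
split; first by have [_ Fm] := mF t (J'J t J't).
by apply: He => i j; exact: (J'P t J't).
Qed.

(** The heat equation holds on a whole neighborhood of [x], so it can be differentiated there. As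
    [f] is only C^2 in space, the derivatives of the Laplacian are obtained from those of [dt I f],
    which [f_mixed] provides. *)
Lemma heat_flow_grad x t : heat_flow U I f -> U x -> I t ->
  has_partials (laplacian (f ^~ t)) x /\
  grad (dt I f ^~ t) x = 2^-1 *: grad (laplacian (f ^~ t)) x.
Proof.
move=> hf Ux It; have [dp _] := f_mixed Ux It.
have nU : nbhs x U by exact: open_nbhs_nbhs.
have lapE : \forall y \near x, (2 *: dt I f ^~ t) y = laplacian (f ^~ t) y.
  apply: filterS nU => y Uy; have h := hf y t Uy It.
  by rewrite /= !fctE h scalerA mulfV// scale1r.
have dlap : has_partials (laplacian (f ^~ t)) x.
  by move=> i; apply: near_eq_derivable lapE _; apply: derivableZ; exact: dp.
split; first exact: dlap.
apply/colP => i; rewrite !mxE -(near_eq_derive _ lapE) deriveZ; last exact: dp.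
by rewrite -[_ *: _]/(_ * _) mulrA mulVf// mul1r.
Qed.

Lemma implicit_curve_heat x0 t0 r J m :
  implicit_curve_at U I F x0 t0 r J m -> heat_flow U I f -> forall t, J t ->
  has_partials (laplacian (f ^~ t)) (m t) /\
  has_derive_within J m t
    (- (2^-1 *: (invmx (hessian (f ^~ t) (m t)) *m grad (laplacian (f ^~ t)) (m t)))).
Proof.
move=> C hf t Jt; have [_ mv] := implicit_curve_velocity C Jt.
move: C => [r0 rU [_ _ [B _ JB]] _ [mF _ _ _ _]].
have It : I t by move: Jt; rewrite JB => -[].
have Umt : U (m t) by have [/rU] := mF t Jt.
have [dlap gE] := heat_flow_grad hf Umt It; split; first exact: dlap.
by rewrite scalemxAr -gE; exact: mv.
Qed.


(** A nonzero gradient stays nonzero nearby by joint continuity. These are the neighborhoods of the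
    covering that meet no branch. *)
Lemma critical_set_near_isolated t0 (K : set 'cV[R]_d) y : I t0 -> K `<=` U -> K y ->
  ~ critical_set K (f ^~ t0) y ->
  \forall z \near y & t \near within I (nbhs t0), U z -> I t -> grad (f ^~ t) z <> 0.
Proof.
move=> It0 KU Ky nC.
have Fy : F y t0 != 0 by apply/eqP => Fy; apply: nC.
have cF := C1_joint_cvg openU grad_C1 (KU _ Ky) It0.
have : \forall z \near within (U `*` I) (nbhs (y, t0)), F z.1 z.2 <> 0.
  move/cvgrPdist_lt : cF => /(_ `|F y t0|); rewrite normr_gt0 => /(_ Fy).
  apply: (@filterS _ (nbhs (y, t0))) => z nz UI Fz0; move: (nz UI).
  by rewrite Fz0 subr0 ltxx.
move=> [[A B] /= [nA nB] AB]; exists (A, B).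
  by split=> //=; exact: cvg_within nB.
by move=> [z t] /= zt Uz It; exact: (AB (z, t)).
Qed.

(** The boundary condition puts every critical point in the interior of [K], so its branch stays in
    [K]. For [t] near [t0] the bijection sends a critical point to the value of its branch at
    [t]. *)
Lemma critical_points_stable t0 (K : set 'cV[R]_d) : I t0 -> compact K -> K `<=` U ->
  (forall x, boundary K x -> ~ critical_at (f ^~ t0) x) ->
  (forall x, K x -> critical_at (f ^~ t0) x -> nondegenerate_at (f ^~ t0) x) ->
  \forall t \near within I (nbhs t0), same_number_and_index K (f ^~ t0) (f ^~ t).
Proof.
move=> It0 cK KU bK ndK; set C0 := critical_set K (f ^~ t0).
have Kclosed : closed K by apply: compact_closed.
have intK x : C0 x -> exists2 r : R, 0 < r & forall y, `|y - x| < r -> K y.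
  move=> [Kx cx]; have /nbhs_ballP[r /= r0 rK] : K° x.
    apply: contrapT => nx; apply: (bK x) cx; split=> //; exact: subset_closure.
  by exists r => // y yx; apply: rK; rewrite -ball_normE /= distrC.
have exC x : exists p : R * set R * (R -> 'cV[R]_d), C0 x ->
    [/\ forall y, `|y - x| < p.1.1 -> K y &
        implicit_curve_at U I F x t0 p.1.1 p.1.2 p.2].
  have [Cx|nCx] := pselect (C0 x); last by exists (0, set0, fun=> 0).
  have [Kx cx] := Cx; have [r0 r00 r0K] := intK x Cx.
  have uJ : jac F x t0 \in unitmx by rewrite jac_grad//; [exact: ndK|exact: KU].
  have [r [J [m [rr0 mP]]]] :=
    implicit_curve openU intervalI grad_C1 (KU _ Kx) It0 cx uJ r00.
  exists (r, J, m) => _; split=> //= y yr; apply: r0K; exact: lt_le_trans yr rr0.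
have [p pP] := choice exC.
pose r x := (p x).1.1; pose J x := (p x).1.2; pose m x := (p x).2.
have rK x : C0 x -> forall y, `|y - x| < r x -> K y by move=> /pP[].
have mP x : C0 x -> implicit_curve_at U I F x t0 (r x) (J x) (m x) by move=> /pP[].
have uniq0 x z : C0 x -> `|z - x| < r x -> C0 z -> z = x.
  move=> Cx zx [_ Fz]; have [_ _ [_ Jt0 _] mt0 [_ uniq _ _ _]] := mP x Cx.
  by rewrite -[RHS]mt0; exact: uniq.
(* Half the radius is what separates distinct branches in the injectivity argument at the end. *)
pose G x t := [/\ J x t, `|m x t - x| < r x / 2 &
  morse_index (f ^~ t) (m x t) = morse_index (f ^~ t0) x].
have nearG x : C0 x -> \forall t \near within I (nbhs t0), G x t.
  move=> Cx; have [r0 _ Jn mt0 [_ _ _ _ [_ mcvg]]] := mP x Cx.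
  have [Kx cx] := Cx.
  have Ux : U x by exact: KU.
  have [e e0 He] :=
    morse_index_stable (hessian_sym openU (f_C2_x It0) Ux) (ndK x Kx cx).
  apply: (subinterval_nbhs_near Jn).
  have nr : \forall s \near within (J x) (nbhs t0), `|m x s - x| < r x / 2.
    have : nbhs (x, t0) [set z : 'cV[R]_d * R | `|z.1 - x| < r x / 2].
      exists ([set z | `|z - x| < r x / 2], setT); last by move=> z [].
      split; last exact: filterT.
      have r20 : 0 < r x / 2 by rewrite divr_gt0.
      by apply: filterS (near_dist_lt x r20) => z; rewrite /= distrC.
    move=> nb; apply: (mcvg (fun z => `|z.1 - x| < r x / 2)).
    by apply: (@filterS _ (nbhs (x, t0)) _ _ _ _ nb).
  have nh : \forall s \near within (J x) (nbhs t0), (U (m x s) /\ I s) /\ forall i j,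
      `|hessian (f ^~ s) (m x s) i j - hessian (f ^~ t0) x i j| <= e.
    apply: (mcvg (fun z => (U z.1 /\ I z.2) /\ forall i j,
      `|hessian (f ^~ z.2) z.1 i j - hessian (f ^~ t0) x i j| <= e)).
    have nz := hessian_near Ux It0 e0.
    by apply: (@filterS _ (nbhs (x, t0)) _ _ _ _ nz) => z nzz UI;
      split; [exact: UI|exact: nzz].
  have nJ : \forall s \near within (J x) (nbhs t0), J x s by exact: withinT.
  near=> s.
  have [[Um Is] close] : (U (m x s) /\ I s) /\ forall i j,
      `|hessian (f ^~ s) (m x s) i j - hessian (f ^~ t0) x i j| <= e by near: s.
  split; [by near: s|by near: s|].
  exact: He (hessian_sym openU (f_C2_x Is) Um) close.
have cover : \forall t \near within I (nbhs t0), forall z, K z ->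
    (C0 z -> G z t) /\ (critical_at (f ^~ t) z -> exists2 x, C0 x & z = m x t).
  have /compact_near_coveringP cov := cK.
  (* Requiring [G z t] at each critical point [z] lets compactness provide a time interval common to
     all branches, along with the absence of other critical points. *)
  pose P t z := K z ->
    (C0 z -> G z t) /\ (critical_at (f ^~ t) z -> exists2 x, C0 x & z = m x t).
  suff covK : \forall t \near within I (nbhs t0), K `<=` P t.
    by apply: (@filterS _ (nbhs t0) _ _ _ _ covK) => t Kt It z Kz; exact: Kt.
  apply: cov => y Ky; have [Cy|nCy] := pselect (C0 y).
    have [r0 _ _ _ [_ uniq _ _ _]] := mP y Cy.
    exists ([set z | `|z - y| < r y], G y).
      split; last exact: nearG.
      by apply: filterS (near_dist_lt y r0) => z; rewrite /= distrC.
    move=> [z t] [/= zy Gt] Kz; have [Jt _ _] := Gt; split.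
      by move=> Cz; rewrite (uniq0 y z Cy zy Cz).
    by move=> cz; exists y; [exact: Cy|exact: uniq].
  have [[A B] /= [nA nB] AB] := critical_set_near_isolated It0 KU Ky nCy.
  exists (A, B `&` I).
    split; first exact: nA.
    by apply: (@filterS _ (nbhs t0) _ _ _ _ nB) => t Bt It; split; [exact: Bt|].
  move=> [z t] [/= Az [Bt It]] Kz; have Uz := KU z Kz; split.
    move=> [_ Fz]; have Bt0 : B t0 by exact: (nbhs_singleton nB It0).
    by case: (AB (z, t0) (conj Az Bt0) Uz It0).
  by move=> cz; case: (AB (z, t) (conj Az Bt) Uz It).
have finC0 : finite_set C0.
  rewrite compact_cover in cK.
  (* These open sets contain no critical point other than possibly their index, so a finite subcover
     leaves finitely many critical points. *)
  pose B y := interior [set z | C0 z -> z = y].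
  have [||D DK cD] := cK _ K B.
  - by move=> y _; exact: open_interior.
  - move=> y Ky; exists y => //.
    rewrite /B /interior /=; have [Cy|nCy] := pselect (C0 y).
      have [r0 _ _ _ _] := mP y Cy.
      apply: filterS (near_dist_lt y r0) => z yz Cz.
      by apply: uniq0; rewrite // distrC.
    have [[A A'] /= [nA nA'] AB] := critical_set_near_isolated It0 KU Ky nCy.
    apply: filterS nA => z Az [Kz Fz].
    by case: (AB (z, t0) (conj Az (nbhs_singleton nA' It0)) (KU z Kz) It0).
  apply: sub_finite_set (finite_fset D) => z Cz.
  have [y yD By] := cD z Cz.1.
  by rewrite /= (interior_subset By Cz).
have nI : \forall t \near within I (nbhs t0), I t by exact: withinT.
near=> t.
have It : I t by near: t.
have H : forall z, K z ->
    (C0 z -> G z t) /\ (critical_at (f ^~ t) z -> exists2 x, C0 x & z = m x t).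
  by near: t.
have Gt x : C0 x -> G x t by move=> Cx; exact: ((H x Cx.1).1 Cx).
have phiC x : C0 x -> critical_set K (f ^~ t) (m x t).
  move=> Cx; have [Jt _ _] := Gt x Cx; have [_ _ _ _ [mF _ _ _ _]] := mP x Cx.
  by have [mr Fm] := mF t Jt; split; [exact: (rK _ Cx)|exact: Fm].
have Csub z : critical_set K (f ^~ t) z -> exists2 x, C0 x & z = m x t.
  by move=> [Kz cz]; exact: ((H z Kz).2 cz).
split.
- exact: finC0.
- apply: sub_finite_set (finite_image (fun x => m x t) finC0) => z /Csub[x Cx ->].
  by exists x.
- by move=> x [Kx cx]; exact: ndK.
- move=> z Cz; have [x Cx zE] := Csub z Cz; have [Jt _ _] := Gt x Cx.
  have [_ _ _ _ [_ _ uJ _ _]] := mP x Cx; have := uJ t Jt.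
  by rewrite -zE jac_grad//; apply: KU; have [] := Cz.
exists (fun x => m x t); last by move=> x Cx; have [] := Gt x Cx.
split.
- by move=> x; exact: phiC.
(* If two branches meet, their base points are at distance less than [r x / 2 + r y / 2], hence less
   than the larger radius, and uniqueness in that ball identifies them. *)
- have inj x y : C0 x -> C0 y -> m x t = m y t -> r y <= r x -> x = y.
    move=> Cx Cy mE ryx; apply/esym; apply: uniq0 => //.
    have [_ mx _] := Gt x Cx; have [_ my _] := Gt y Cy; rewrite -mE in my.
    rewrite (le_lt_trans (ler_distD (m x t) _ _))// (distrC y).
    lra.
  move=> x y /set_mem Cx /set_mem Cy mE.
  have [yx|/ltW xy] := leP (r y) (r x); first exact: inj.
  by apply/esym; exact: inj.
- by move=> z /Csub[x Cx ->]; exists x.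
Unshelve. all: by end_near. Qed.


End CriticalPointsOfFamily.

Unset Implicit Arguments.

Theorem theorem4p1 (R : realType) (d : nat) (U : set 'cV[R]_d) (I : set R)
    (f : 'cV[R]_d -> R -> R)
    (openU : open U) (intervalI : is_interval I)
    (f_C2_x : forall t, I t -> C2_on U (f ^~ t))
    (f_diff_t : forall x t, U x -> I t -> derivable_within I (f x) t)
    (grad_C1 : C1_space_time U I (fun x t => grad (f ^~ t) x))
    (f_mixed : mixed_derivatives_commute U I f) :
  (forall (x0 : 'cV[R]_d) (t0 : R), U x0 -> I t0 ->
    critical_at (f ^~ t0) x0 -> nondegenerate_at (f ^~ t0) x0 ->
    exists (V : set 'cV[R]_d) (J : set R) (m : R -> 'cV[R]_d),
      [/\ [/\ open V, V x0 & V `<=` U],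
          subinterval_nbhs I t0 J,
          critical_curve f x0 t0 J V m,
          forall m' : R -> 'cV[R]_d, critical_curve f x0 t0 J V m' ->
            forall t, J t -> m' t = m t
        & [/\ forall t, J t ->
                nondegenerate_at (f ^~ t) (m t) /\
                has_derive_within J m t
                  (- (invmx (hessian (f ^~ t) (m t))
                      *m grad (dt I f ^~ t) (m t))),
              negative_definite (hessian (f ^~ t0) x0) ->
                exists J' : set R,
                  [/\ subinterval_nbhs I t0 J', J' `<=` J
                    & forall t, J' t -> local_mode (f ^~ t) (m t)]
            & heat_flow U I f ->
                forall t, J t ->
                  has_partials (laplacian (f ^~ t)) (m t) /\
                  has_derive_within J m t
                    (- (2^-1 *: (invmx (hessian (f ^~ t) (m t))
                                 *m grad (laplacian (f ^~ t)) (m t))))]]) /\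
  (forall (t0 : R) (K : set 'cV[R]_d), I t0 -> compact K -> K `<=` U ->
    (forall x, boundary K x -> ~ critical_at (f ^~ t0) x) ->
    (forall x, K x -> critical_at (f ^~ t0) x -> nondegenerate_at (f ^~ t0) x) ->
    \forall t \near within I (nbhs t0),
      same_number_and_index K (f ^~ t0) (f ^~ t)).
Proof.
split=> [x0 t0 Ux0 It0 F0 uH|t0 K It0 cK KU bK ndK]; last first.
  exact: (critical_points_stable openU intervalI f_C2_x grad_C1 It0 cK KU bK ndK).
have uJ : jac (fun x t => grad (f ^~ t) x) x0 t0 \in unitmx.
  by rewrite (jac_grad grad_C1 Ux0 It0).
(* Any positive bound on the radius would do here, and 1 is taken. *)
have [r [J [m [_ mC]]]] :=
  implicit_curve openU intervalI grad_C1 Ux0 It0 F0 uJ ltr01.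
have [nV nJ cm um] := implicit_curve_critical mC.
exists (ball x0 r), J, m; split; [exact: nV|exact: nJ|exact: cm|exact: um|].
split.
- exact: (implicit_curve_velocity grad_C1 f_mixed mC).
- exact: (implicit_curve_local_modes openU intervalI f_C2_x grad_C1 Ux0 It0 mC).
- exact: (implicit_curve_heat openU grad_C1 f_mixed mC).
Qed.
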